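(* Let $(L,\Delta)$ be a differentially closed field of characteristic zero with $m$ commuting derivations $\Delta$, and let $R$ be a local finite-dimensional $L$-algebra equipped with commuting derivations (also denoted $\Delta$) extending those of $L$, such that the maximal ideal $\mathfrak m$ of $R$ is a $\Delta$-ideal. Let $\Lambda=\{f_1,\dots,f_s\}\subset R\{x\}$ be a coherent set of differential polynomials in one variable $x$ over $R$. Suppose $a\in L$ satisfies $\operatorname{res}(f)(a)=0$ for all $f\in\Lambda$ and $\operatorname{res}(H_\Lambda)(a)\neq0$. Then there exists $b\in R$ with $\operatorname{res}(b)=a$ and $f(b)=0$ for all $f\in\Lambda$.
   Context: Since $L$ is algebraically closed, the residue field $R/\mathfrak m$ is $L$; $\operatorname{res}:R\to L$ is the residue map, extended coefficientwise to $R\{x\}\to L\{x\}$. All rings are commutative and unital. $R\{x\}=R[\Theta x]$ is the differential polynomial ring, with $\Theta$ the free commutative monoid on $\Delta=\{\delta_1,\dots,\delta_m\}$ and $\Theta x=\{\theta x:\theta\in\Theta\}$. Indeterminates are ranked by $\delta_m^{e_m}\cdots\delta_1^{e_1}x<\delta_m^{r_m}\cdots\delta_1^{r_1}x$ iff $(\sum e_k,e_m,\dots,e_1)<(\sum r_k,r_m,\dots,r_1)$ lexicographically. For $f\in R\{x\}\setminus R$: the leader $v_f$ is the highest-ranked indeterminate in $f$, $d_f$ its degree in $f$, the separant $S_f=\partial f/\partial v_f$, the initial $I_f$ the leading coefficient of $f$ in $v_f$; $H_\Lambda:=\prod_{f\in\Lambda}I_fS_f$. A subset $\Lambda\subset R\{x\}\setminus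 R$ is coherent if (1) for all $f\neq g$ in $\Lambda$, no proper derivative of $v_f$ appears in $g$, and if $v_f$ appears in $g$ then with degree $<d_f$; and (2) whenever $f\neq g$ in $\Lambda$ and $\theta_f,\theta_g\in\Theta$ with $\theta_fv_f=\theta_gv_g=:v$, $v$ least such, there is $N$ with $H_\Lambda^N(S_g\theta_ff-S_f\theta_gg)\in(\Lambda)_v$, the ideal generated by $\{\theta f:f\in\Lambda,\theta\in\Theta,v_{\theta f}<v\}$. *)

(* Defs.v *)
From HB Require Import structures.
From mathcomp Require Import all_boot all_order all_algebra.
From mathcomp Require Import finmap.
From mathcomp.multinomials Require Import monalg.
From Stdlib Require Import ClassicalEpsilon.
Set Implicit Arguments. Unset Strict Implicit. Unset Printing Implicit Defensive.
Import GRing.Theory.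
Local Open Scope ring_scope.

Definition is_derivation (A : pzRingType) (d : A -> A) : Prop :=
  (forall x y, d (x + y) = d x + d y) /\ (forall x y, d (x * y) = d x * y + x * d y).

Definition commuting_derivations (A : pzRingType) (m : nat) (d : 'I_m -> A -> A) : Prop :=
  (forall i, is_derivation (d i)) /\ (forall i j x, d i (d j x) = d j (d i x)).

(* Theta = free commutative monoid on Delta: theta = delta_m^{e_m}...delta_1^{e_1}
   is encoded by its exponent vector e : 'I_m -> nat (e i = exponent of delta_{i+1}). *)
Definition Theta (m : nat) := {ffun 'I_m -> nat}.

Definition apply_theta (A : Type) (m : nat) (d : 'I_m -> A -> A) (t : Theta m) (x : A) : A :=
  foldr (fun i y => iter (t i) (d i) y) x (enum 'I_m).

Definition tadd m (t t' : Theta m) : Theta m := [ffun j => t j + t' j]%N.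
Definition tshift m (t : Theta m) (i : 'I_m) : Theta m := [ffun j => t j + (i == j)]%N.
(* t' is a derivative of t, i.e. t' = theta t for some theta *)
Definition tle m (t t' : Theta m) : bool := [forall j, t j <= t' j]%N.

(* indeterminates theta x_k, k < n *)
Definition dvar (n m : nat) := ('I_n * Theta m)%type.
(* A{x_1..x_n} = A[Theta x_1, ..., Theta x_n] *)
Notation DP A n m := ({malg A[cmonom (dvar n m)]}) (only parsing).

(* extension of the derivation d_i of A to A{x}: delta_i (theta x) = (delta_i theta) x *)
Definition dp_deriv (A : comNzRingType) n m (d : 'I_m -> A -> A) (i : 'I_m)
    (f : DP A n m) : DP A n m :=
  \sum_(mu <- msupp f)
     (<< d i f@_mu *g mu >> +
      \sum_(v <- finsupp mu)
         << f@_mu *+ mu v *g mulcm (divcm mu (ucm v)) (ucm (v.1, tshift v.2 i)) >>).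

Definition dp_theta (A : comNzRingType) n m (d : 'I_m -> A -> A) (t : Theta m)
    (f : DP A n m) : DP A n m :=
  apply_theta (dp_deriv d) t f.

Definition dp_eval (A : comNzRingType) n m (d : 'I_m -> A -> A) (f : DP A n m)
    (b : 'I_n -> A) : A :=
  \sum_(mu <- msupp f)
     f@_mu * \prod_(v <- finsupp mu) (apply_theta d v.2 (b v.1)) ^+ mu v.

Definition dp_map (A B : comNzRingType) n m (phi : A -> B) (f : DP A n m) : DP B n m :=
  \sum_(mu <- msupp f) << phi f@_mu *g mu >>.

(* Kolchin's definition: every finite system of differential polynomial equations
   and inequations over L (in finitely many indeterminates) having a solution in
   some differential field extension of L already has a solution in L. *)
Definition diff_closed (L : fieldType) (m : nat) (dL : 'I_m -> L -> L) : Prop :=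
  forall (K : fieldType) (dK : 'I_m -> K -> K) (iota : {rmorphism L -> K}),
    commuting_derivations dK ->
    (forall i c, iota (dL i c) = dK i (iota c)) ->
    forall (n : nat) (eqs neqs : seq (DP L n m)),
      (exists b : 'I_n -> K,
         (forall f, f \in eqs -> dp_eval dK (dp_map iota f) b = 0) /\
         (forall g, g \in neqs -> dp_eval dK (dp_map iota g) b != 0)) ->
      exists a : 'I_n -> L,
         (forall f, f \in eqs -> dp_eval dL f a = 0) /\
         (forall g, g \in neqs -> dp_eval dL g a != 0).

Definition finite_dim (L : fieldType) (R : comAlgType L) : Prop :=
  exists (n : nat) (e : 'I_n -> R), forall r : R, exists c : 'I_n -> L,
    r = \sum_(i < n) c i *: e i.

Definition is_ideal (R : comNzRingType) (I : R -> Prop) : Prop :=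
  I 0 /\ (forall x y, I x -> I y -> I (x + y)) /\ (forall r x, I x -> I (r * x)).

Definition is_maximal_ideal (R : comNzRingType) (I : R -> Prop) : Prop :=
  is_ideal I /\ ~ I 1 /\
  forall J : R -> Prop, is_ideal J -> ~ J 1 -> (forall x, I x -> J x) -> forall x, J x -> I x.

Definition local_with (R : comNzRingType) (mm : R -> Prop) : Prop :=
  is_maximal_ideal mm /\ forall J, is_maximal_ideal J -> forall x, J x <-> mm x.

(* residue map R -> R/mm = L : res r is the c in L with r - c in mm *)
Definition residue (L : fieldType) (R : comAlgType L) (mm : R -> Prop) (r : R) : L :=
  epsilon (inhabits 0) (fun c : L => mm (r - c%:A)).

Definition xv m (t : Theta m) : dvar 1 m := (ord0, t).

Fixpoint lex_lt (s t : seq nat) : bool :=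
  match s, t with
  | a :: s', b :: t' => (a < b)%N || ((a == b) && lex_lt s' t')
  | _, _ => false
  end.

Definition rank_key m (t : Theta m) : seq nat :=
  (\sum_(i < m) t i)%N :: [seq t i | i <- rev (enum 'I_m)].
Definition rank_lt m (t t' : Theta m) : bool := lex_lt (rank_key t) (rank_key t').

Definition dp_vars (A : comNzRingType) m (f : DP A 1 m) : seq (Theta m) :=
  flatten [seq [seq v.2 | v <- (finsupp (cmonom_val mu) : seq _)] | mu <- (msupp f : seq _)].

Definition appears (A : comNzRingType) m (t : Theta m) (f : DP A 1 m) : bool :=
  t \in dp_vars f.

Definition dp_const (A : comNzRingType) m (f : DP A 1 m) : bool := nilp (dp_vars f).

Definition leader (A : comNzRingType) m (f : DP A 1 m) : Theta m :=
  foldr (fun t acc => if rank_lt acc t then t else acc)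
        (head [ffun => 0%N] (dp_vars f)) (dp_vars f).

Definition deg_in (A : comNzRingType) m (t : Theta m) (f : DP A 1 m) : nat :=
  (\max_(mu <- msupp f) mu (xv t))%N.

Definition ldeg (A : comNzRingType) m (f : DP A 1 m) : nat := deg_in (leader f) f.

Definition initial (A : comNzRingType) m (f : DP A 1 m) : DP A 1 m :=
  \sum_(mu <- msupp f | mu (xv (leader f)) == ldeg f)
     << f@_mu *g divcm mu (expcmn (ucm (xv (leader f))) (ldeg f)) >>.

Definition separant (A : comNzRingType) m (f : DP A 1 m) : DP A 1 m :=
  \sum_(mu <- msupp f)
     << f@_mu *+ mu (xv (leader f)) *g divcm mu (ucm (xv (leader f))) >>.

Definition H_Lambda (A : comNzRingType) m (Lam : seq (DP A 1 m)) : DP A 1 m :=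
  \prod_(f <- Lam) (initial f * separant f).

Definition in_ideal (A : comNzRingType) (S : A -> Prop) (x : A) : Prop :=
  exists (k : nat) (c g : 'I_k -> A), (forall j, S (g j)) /\ x = \sum_(j < k) c j * g j.

Definition Lam_gens (A : comNzRingType) m (d : 'I_m -> A -> A) (Lam : seq (DP A 1 m))
    (v : Theta m) (h : DP A 1 m) : Prop :=
  exists f t, f \in Lam /\ h = dp_theta d t f /\ rank_lt (leader h) v.

Definition coherent (A : comNzRingType) m (d : 'I_m -> A -> A) (Lam : seq (DP A 1 m)) : Prop :=
  (forall f g, f \in Lam -> g \in Lam -> f != g ->
     (forall t, appears t g -> ~ (tle (leader f) t /\ t != leader f)) /\
     (appears (leader f) g -> (deg_in (leader f) g < ldeg f)%N)) /\
  (forall f g, f \in Lam -> g \in Lam -> f != g ->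
   forall tf tg : Theta m,
     tadd tf (leader f) = tadd tg (leader g) ->
     (forall tf' tg' : Theta m, tadd tf' (leader f) = tadd tg' (leader g) ->
        ~~ rank_lt (tadd tf' (leader f)) (tadd tf (leader f))) ->
     exists N : nat,
       in_ideal (Lam_gens d Lam (tadd tf (leader f)))
         (H_Lambda Lam ^+ N *
            (separant g * dp_theta d tf f - separant f * dp_theta d tg g))).

(* Main.v *)
(* A zero of Lam is first built without its derivations: a family Y of elements of R,
   one for each derivative theta x, that lifts the family theta a and kills every
   theta f.  It is chosen by recursion on the rank of theta x.  If theta x is the leader
   of some f, Hensel's lemma applies, because the separant of f is invertible and the
   maximal ideal is nil; if it is a proper derivative of a leader, the equation is linear
   with the separant as coefficient; coherence makes all these equations agree.

   Such a family is an element of the differential ring H(R) of Hurwitz series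
   Theta -> R, into which R embeds by c |-> (theta c)_theta, and there it is a
   differential zero of Lam.  A basis of R over L is also a basis of H(R) over H(L), so
   the coordinates of Y solve in H(L) a system of differential equations over L that
   expresses f(b) = 0 and res b = a.  As H(L) is a domain in characteristic zero, the
   system has a solution in a differential field over L, hence in L. *)

Require Import Defs.
From HB Require Import structures.
From mathcomp Require Import all_boot all_order all_algebra.
From mathcomp Require Import finmap.
From mathcomp.multinomials Require Import monalg.
From mathcomp Require Import generic_quotient ring_quotient fraction.
From mathcomp Require Import boolp zify ring.
From Stdlib Require Import ClassicalEpsilon.
Set Implicit Arguments. Unset Strict Implicit. Unset Printing Implicit Defensive.
Import GRing.Theory.
Local Open Scope ring_scope.

(** * Exponents and ranks *)

(** The obstacle is that the family Y need not satisfy Y(delta theta) = delta Y(theta) in R, so it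
    is not the sequence of derivatives of an element of R, while differential closedness speaks only
    of L. In H(R) the derivations are shifts of the index, and the coefficient of f(Y) at theta is
    the value of theta f at Y; this is why every theta f, and not only f, has to vanish at Y.
    Elements of L are in general not constants, so both L and the basis of R enter Hurwitz series
    through all their derivatives, which makes L -> H(L) a differential extension. The system over L
    arises by evaluating f at a generic element of R, the sum of the e_i x_i with differential
    indeterminates x_i, and splitting the coefficients of the result over the basis. Coherence gives
    a relation only at the least common derivative of two leaders, up to a power of H_Lambda, and
    measures generators by their actual leaders. It is carried to all common derivatives by
    differentiation, and the leader of theta f is identified with theta v_f because the separant
    does not vanish at a. *)

Definition tzero m : Theta m := [ffun => 0%N].
Definition tdeg m (t : Theta m) : nat := (\sum_(i < m) t i)%N.

Section Theta.
Variable m : nat.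
Implicit Types (t u v : Theta m) (i j : 'I_m).

Lemma taddC t u : tadd t u = tadd u t.
Proof. by apply/ffunP => j; rewrite !ffunE addnC. Qed.

Lemma tadd0 t : tadd t (tzero m) = t.
Proof. by apply/ffunP => j; rewrite !ffunE addn0. Qed.

Lemma t0add t : tadd (tzero m) t = t.
Proof. by rewrite taddC tadd0. Qed.

Lemma taddA t u v : tadd t (tadd u v) = tadd (tadd t u) v.
Proof. by apply/ffunP => j; rewrite !ffunE addnA. Qed.

Lemma taddI t u v : tadd t v = tadd u v -> t = u.
Proof.
move=> /ffunP E; apply/ffunP => j.
by have:= E j; rewrite !ffunE => /addIn.
Qed.

Lemma tshift_addl t u i : tadd (tshift t i) u = tshift (tadd t u) i.
Proof. by apply/ffunP => j; rewrite !ffunE addnAC. Qed.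

Lemma tshift_addr t u i : tadd t (tshift u i) = tshift (tadd t u) i.
Proof. by apply/ffunP => j; rewrite !ffunE addnA. Qed.

Lemma tshiftC t i j : tshift (tshift t i) j = tshift (tshift t j) i.
Proof. by apply/ffunP => k; rewrite !ffunE addnAC. Qed.

Lemma tdeg_shift t i : tdeg (tshift t i) = (tdeg t).+1.
Proof.
rewrite /tdeg -addn1 -[in RHS](_ : \sum_(j < m) (i == j) = 1)%N.
  by rewrite -big_split /=; apply: eq_bigr => j _; rewrite ffunE.
by rewrite (bigD1 i) //= eqxx big1 // => j /negPf; rewrite eq_sym => ->.
Qed.

Lemma tdeg_eq0 t : (tdeg t == 0%N) = (t == tzero m).
Proof.
apply/idP/eqP => [|->].
  rewrite sum_nat_eq0 => /forallP H; apply/ffunP => j.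
  by rewrite ffunE; apply/eqP; have:= H j.
by rewrite /tdeg big1 // => j _; rewrite ffunE.
Qed.

Lemma tshift_pred t i : (0 < t i)%N -> exists u, t = tshift u i.
Proof.
move=> ti; exists [ffun j => t j - (i == j)]%N.
apply/ffunP => j; rewrite !ffunE; case: eqP => [<-|_]; first by rewrite subnK.
by rewrite subn0 addn0.
Qed.

Lemma Theta_ind (P : Theta m -> Prop) :
  P (tzero m) -> (forall t i, P t -> P (tshift t i)) -> forall t, P t.
Proof.
move=> P0 PS t; move En: (tdeg t) => n; elim: n t En => [|n IH] t.
  by move/eqP; rewrite tdeg_eq0 => /eqP->.
move=> En; have: tdeg t != 0%N by rewrite En.
rewrite sum_nat_eq0 negb_forall => /existsP[i /=]; rewrite -lt0n => ti.
have [u eu] := tshift_pred ti.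
by rewrite eu; apply: PS; apply: IH; move: En; rewrite eu tdeg_shift => -[].
Qed.

Lemma tshift_neq0 t i : tshift t i != tzero m.
Proof. by rewrite -tdeg_eq0 tdeg_shift. Qed.

Lemma Theta_case t : t = tzero m \/ exists u i, t = tshift u i.
Proof. by elim/Theta_ind: t => [|t i _]; [left|right; exists t, i]. Qed.

Lemma tle_addP t u : reflect (exists v, u = tadd v t) (tle t u).
Proof.
apply: (iffP forallP) => [le|[v -> j]]; last by rewrite ffunE leq_addl.
exists [ffun j => u j - t j]%N; apply/ffunP => j.
by rewrite !ffunE subnK.
Qed.

Section ApplyTheta.
Variables (A : Type) (d : 'I_m -> A -> A).
Hypothesis dC : forall i j x, d i (d j x) = d j (d i x).

Lemma apply_theta0 x : apply_theta d (tzero m) x = x.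
Proof.
rewrite /apply_theta; elim: (enum _) => //= i s ->.
by rewrite ffunE.
Qed.

Lemma iter_derC i j n x : iter n (d i) (d j x) = d j (iter n (d i) x).
Proof. by elim: n => //= n ->; rewrite dC. Qed.

Lemma apply_thetaS t i x : apply_theta d (tshift t i) x = d i (apply_theta d t x).
Proof.
have E s : uniq s ->
    foldr (fun j y => iter (tshift t i j) (d j) y) x s
    = iter (i \in s) (d i) (foldr (fun j y => iter (t j) (d j) y) x s).
  elim: s => //= j s IH /andP[js us]; rewrite IH // inE ffunE.
  case: (eqVneq i j) js => [<- /negPf->|ne js] /=; first by rewrite addn1 iterS.
  rewrite addn0; case: (i \in s) => //=; exact: iter_derC.
by rewrite /apply_theta E ?enum_uniq // mem_enum.
Qed.

Lemma apply_thetaSr t i x : apply_theta d (tshift t i) x = apply_theta d t (d i x).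
Proof.
elim/Theta_ind: t => [|t j IH]; first by rewrite apply_thetaS !apply_theta0.
by rewrite tshiftC apply_thetaS IH -apply_thetaS.
Qed.

End ApplyTheta.

Lemma apply_theta_morph (A B : Type) (d : 'I_m -> A -> A) (d' : 'I_m -> B -> B)
    (phi : A -> B) (phid : forall i x, phi (d i x) = d' i (phi x)) t x :
  phi (apply_theta d t x) = apply_theta d' t (phi x).
Proof.
rewrite /apply_theta; elim: (enum _) => //= i s <-.
by elim: (t i) => //= n <-; rewrite phid.
Qed.

End Theta.

(** * The lexicographic order and the ranking of derivatives *)

Section LexLt.
Implicit Types s t u : seq nat.

Lemma lex_lt_irr s : lex_lt s s = false.
Proof. by elim: s => //= a s ->; rewrite ltnn andbF. Qed.

Lemma lex_lt_trans t s u : lex_lt s t -> lex_lt t u -> lex_lt s u.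
Proof.
elim: t s u => [|b t IH] [|a s] [|c u] //=.
case/orP => [ab|/andP[/eqP-> st]]; case/orP => [bc|/andP[/eqP<- tu]].
- by rewrite (ltn_trans ab bc).
- by rewrite ab.
- by rewrite bc.
- by rewrite eqxx (IH _ _ st tu) orbT.
Qed.

Lemma lex_lt_total s t : size s = size t -> s != t -> lex_lt s t || lex_lt t s.
Proof.
elim: s t => [|a s IH] [|b t] //= [/IH{}IH].
rewrite eqseq_cons; case: ltngtP => //= -> /=; exact: IH.
Qed.

Lemma lex_lt_add (I : Type) (r : seq I) (f g h : I -> nat) :
  lex_lt [seq (f i + h i)%N | i <- r] [seq (g i + h i)%N | i <- r]
  = lex_lt [seq f i | i <- r] [seq g i | i <- r].
Proof. by elim: r => //= i r ->; rewrite ltn_add2r eqn_add2r. Qed.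

(** Without a fixed length the order is not well founded: [1], [0;1], [0;0;1], ... descends forever.
    Hence the equality of sizes in the relation. The induction is nested: on the length, on a bound
    for the head, on the accessibility of the tail. *)
Lemma lex_lt_Acc n t : size t = n ->
  Acc (fun s u => size s = size u /\ lex_lt s u) t.
Proof.
elim: n t => [|n IH] t.
  by move/size0nil=> ->; apply: Acc_intro => s [_]; case: s.
suff H c : forall b t, (b < c)%N -> size t = n ->
    Acc (fun s u => size s = size u /\ lex_lt s u) (b :: t).
  case: t => [|b t] st; first discriminate st.
  exact: (H b.+1 b t (ltnSn b) (succn_inj st)).
elim: c => [|c IHc] b {}t bc st; first by rewrite ltn0 in bc.
have acct := IH t st; elim: acct st => {}t _ IHt st.
apply: Acc_intro => s; case: s => [[] //|a s] [] /= [ss] /orP[ab|/andP[/eqP-> lst]].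
  apply: IHc; [exact: (leq_trans ab) | exact: (etrans ss)].
apply: IHt; [by split | exact: (etrans ss)].
Qed.

End LexLt.

Section Rank.
Variable m : nat.
Implicit Types (t u v : Theta m) (i j : 'I_m).

Lemma rank_lt_irr t : rank_lt t t = false.
Proof. exact: lex_lt_irr. Qed.

Lemma rank_lt_trans u t v : rank_lt t u -> rank_lt u v -> rank_lt t v.
Proof. exact: lex_lt_trans. Qed.

Lemma rank_lt_asym t u : rank_lt t u -> ~~ rank_lt u t.
Proof.
by move=> tu; apply/negP => /(rank_lt_trans tu); rewrite rank_lt_irr.
Qed.

Lemma rank_lt_total t u : t != u -> rank_lt t u || rank_lt u t.
Proof.
move=> ne; apply: lex_lt_total; first by rewrite /= !size_map.
apply: contra ne; rewrite /rank_key eqseq_cons => /andP[_ /eqP E].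
apply/eqP/ffunP => j; move/eq_in_map: E; apply.
by rewrite mem_rev mem_enum.
Qed.

Lemma rank_lt_add2r v t u : rank_lt (tadd t v) (tadd u v) = rank_lt t u.
Proof.
(* The total degree is additive just like the exponents; placing it at the extra index [None] makes
   a key the list of values of one additive function. *)
pose f t' (o : option 'I_m) := if o is Some i then t' i else tdeg t'.
have keyE t' : rank_key t' = [seq f t' o | o <- None :: [seq Some i | i <- rev (enum 'I_m)]].
  by rewrite /rank_key /= -map_comp; congr (_ :: _); apply: eq_map.
have fE t' : f (tadd t' v) =1 (fun o => f t' o + f v o)%N.
  move=> [i|] /=; first by rewrite ffunE.
  by rewrite /tdeg -big_split; apply: eq_bigr => i _; rewrite ffunE.
by rewrite /rank_lt !keyE !(eq_map (fE _)) lex_lt_add.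
Qed.

Lemma rank_lt_tshift2 t u i : rank_lt (tshift t i) (tshift u i) = rank_lt t u.
Proof.
have E w : tshift w i = tadd w (tshift (tzero m) i) by rewrite tshift_addr tadd0.
by rewrite (E t) (E u) rank_lt_add2r.
Qed.

Lemma rank_lt_deg t u : (tdeg t < tdeg u)%N -> rank_lt t u.
Proof. by rewrite /rank_lt /rank_key /= => ->. Qed.

Lemma rank_lt_tshift t i : rank_lt t (tshift t i).
Proof. by apply: rank_lt_deg; rewrite tdeg_shift. Qed.

Lemma rank_lt_addl t u : t != tzero m -> rank_lt u (tadd t u).
Proof.
move=> t0; apply: rank_lt_deg.
rewrite [ltnRHS](_ : _ = tdeg t + tdeg u)%N; last first.
  by rewrite /tdeg -big_split; apply: eq_bigr => i _; rewrite ffunE.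
by rewrite -[ltnLHS]add0n ltn_add2r lt0n tdeg_eq0.
Qed.

Lemma tle_rank_ge t u : tle t u -> ~~ rank_lt u t.
Proof.
move/tle_addP => [v ->]; case: (eqVneq v (tzero m)) => [->|v0].
  by rewrite t0add rank_lt_irr.
exact/rank_lt_asym/rank_lt_addl.
Qed.

Lemma rank_lt_wf : well_founded (fun t u : Theta m => rank_lt t u).
Proof.
move=> t; move: {1}(rank_key t) (erefl (rank_key t)) (lex_lt_Acc (erefl (size (rank_key t)))) => s es acc.
rewrite -es in acc; elim: acc t es => {}s _ IH t es.
apply: Acc_intro => u ltu; apply: (IH (rank_key u)); last reflexivity.
by rewrite es; split; first rewrite /= !size_map.
Qed.

End Rank.

(** * Differential polynomials and their evaluation *)

Section Derivation.
Variables (A : comNzRingType) (d : A -> A).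
Hypothesis dder : is_derivation d.

Lemma derD : {morph d : x y / x + y}.
Proof. by case: dder. Qed.

Lemma derM x y : d (x * y) = d x * y + x * d y.
Proof. by case: dder. Qed.

Lemma der0 : d 0 = 0.
Proof. by apply: (addrI (d 0)); rewrite -derD !addr0. Qed.

Lemma der1 : d 1 = 0.
Proof.
have := derM 1 1; rewrite !mulr1 !mul1r => E.
by apply: (addrI (d 1)); rewrite addr0 -E.
Qed.

Lemma derN : {morph d : x / - x}.
Proof. by move=> x; apply: (addrI (d x)); rewrite -derD !subrr der0. Qed.

Lemma derB : {morph d : x y / x - y}.
Proof. by move=> x y; rewrite derD derN. Qed.

Lemma derX n x : d (x ^+ n.+1) = x ^+ n * d x *+ n.+1.
Proof.
elim: n => [|n IH]; first by rewrite expr1 expr0 mul1r.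
by rewrite exprS derM IH mulrnAr mulrA -exprS mulrC -mulrS.
Qed.

End Derivation.

Section PolyEval.
Variable I : choiceType.

Definition cmval (S : comNzRingType) (w : I -> S) (mu : cmonom I) : S :=
  \prod_(v <- finsupp mu) w v ^+ mu v.

Section Cmval.
Variables (S : comNzRingType) (w : I -> S).

Lemma cmvalEw (E : {fset I}) (mu : cmonom I) : (finsupp mu `<=` E)%fset ->
  cmval w mu = \prod_(v <- E) w v ^+ mu v.
Proof.
move=> le; apply: big_fset_incl le _ => v _.
by rewrite -cmE_eq0 => /eqP->; rewrite expr0.
Qed.

Lemma cmval_mmorphism : mmorphism (cmval w).
Proof.
split=> [mu nu|]; last by rewrite /cmval mdom1 big_seq_fset0.
rewrite (cmvalEw (E := (finsupp mu `|` finsupp nu)%fset) (mu := mu)) ?fsubsetUl //.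
rewrite (cmvalEw (E := (finsupp mu `|` finsupp nu)%fset) (mu := nu)) ?fsubsetUr //.
rewrite /cmval mdomD -big_split; apply: eq_bigr => v _ /=.
by rewrite cmM exprD.
Qed.

HB.instance Definition _ := isMultiplicative.Build (cmonom I) S (cmval w) cmval_mmorphism.

Lemma cmvalU v : cmval w (ucm v) = w v.
Proof. by rewrite /cmval mdomU big_seq_fset1 cmUU expr1. Qed.

End Cmval.
End PolyEval.

(* Locked: otherwise comparing two distinct values unfolds both polynomials. *)
HB.lock Definition aeval (I : choiceType) (A S : comNzRingType) (phi : A -> S) (w : I -> S)
  (f : {malg A[cmonom I]}) : S := mmap phi (cmval w) f.

HB.lock Definition mconst (I : choiceType) (A : comNzRingType) (c : A) : {malg A[cmonom I]} :=
  c%:MP.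

HB.lock Definition mvar (I : choiceType) (A : comNzRingType) (v : I) : {malg A[cmonom I]} :=
  << ucm v >>.

Section Mconst.
Variables (I : choiceType) (A : comNzRingType).

Lemma mconst_is_zmod_morphism : zmod_morphism (@mconst I A).
Proof. by move=> c e; rewrite unlock; exact: monalgUB. Qed.

Lemma mconst_is_monoid_morphism : monoid_morphism (@mconst I A).
Proof. rewrite unlock; split=> [|c e]; [reflexivity | exact: mpolyCM]. Qed.

HB.instance Definition _ := GRing.isZmodMorphism.Build A {malg A[cmonom I]} (@mconst I A)
  mconst_is_zmod_morphism.
HB.instance Definition _ := GRing.isMonoidMorphism.Build A {malg A[cmonom I]} (@mconst I A)
  mconst_is_monoid_morphism.

End Mconst.

Section PolyEval.
Variable I : choiceType.

Lemma aevalE (A S : comNzRingType) (phi : A -> S) (w : I -> S) (f : {malg A[cmonom I]}) :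
  aeval phi w f = \sum_(mu <- msupp f) phi f@_mu * cmval w mu.
Proof. by rewrite unlock. Qed.

Section Aeval.
Variables (A S : comNzRingType) (phi : {rmorphism A -> S}) (w : I -> S).

Lemma aeval_is_zmod_morphism : zmod_morphism (aeval phi w).
Proof. rewrite unlock; exact: (raddfB (mmap phi (cmval w))). Qed.

Lemma aeval_is_monoid_morphism : monoid_morphism (aeval phi w).
Proof.
by rewrite unlock; split; [exact: rmorph1 | exact: (rmorphM (mmap phi (cmval w)))].
Qed.

HB.instance Definition _ := GRing.isZmodMorphism.Build {malg A[cmonom I]} S (aeval phi w)
  aeval_is_zmod_morphism.
HB.instance Definition _ := GRing.isMonoidMorphism.Build {malg A[cmonom I]} S (aeval phi w)
  aeval_is_monoid_morphism.

Lemma aevalC c : aeval phi w (mconst I c) = phi c.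
Proof. rewrite !unlock; exact: mmapC. Qed.

Lemma aevalU c mu : aeval phi w << c *g mu >> = phi c * cmval w mu.
Proof. rewrite unlock; exact: mmapU. Qed.

Lemma aevalX v : aeval phi w (mvar A v) = w v.
Proof. by rewrite [mvar]unlock aevalU rmorph1 mul1r cmvalU. Qed.

End Aeval.

Section Vars.
Variable A : comNzRingType.
Implicit Types (f g : {malg A[cmonom I]}) (P Q : I -> Prop).

Lemma malgUM (c e : A) (mu nu : cmonom I) :
  << c *g mu >> * << e *g nu >> = << c * e *g mulcm mu nu >> :> {malg A[cmonom I]}.
Proof. by rewrite malgM_def fgmulUU. Qed.

Lemma malg_addind (T : {malg A[cmonom I]} -> Prop) :
  T 0 -> (forall (c : A) (mu : cmonom I), T << c *g mu >>) ->
  (forall f g, T f -> T g -> T (f + g)) -> forall f, T f.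
Proof.
move=> T0 TU TD f; rewrite [f]monalgE; elim/big_rec: _ => // mu g _ Tg.
exact/TD.
Qed.

Lemma malgU_ext (c : A) (mu nu : cmonom I) : (forall u, mu u = nu u) ->
  << c *g mu >> = << c *g nu >> :> {malg A[cmonom I]}.
Proof. by move=> E; have -> : mu = nu by apply/eqP/cmP. Qed.

(** Splitting monomials into indeterminates is what allows [malg_ind] to reduce identities between
    morphisms and derivations to constants and indeterminates. *)
Lemma malgUCX (c : A) (mu : cmonom I) :
  << c *g mu >> = c%:MP * \prod_(v <- finsupp mu) << ucm v >> ^+ mu v :> {malg A[cmonom I]}.
Proof.
have mul1cm (nu : cmonom I) : mulcm (mone (s := cmonom I)) nu = nu by exact: mul1m.
rewrite -[c in LHS]mulr1 -[mu in LHS]mul1cm -malgUM; congr (_ * _).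
have expcmS (v : I) n : expcmn (ucm v) n.+1 = mulcm (ucm v) (expcmn (ucm v) n).
  by case: n => [|n]; first by rewrite mulcm0.
have expE (v : I) n : << ucm v >> ^+ n = << expcmn (ucm v) n >> :> {malg A[cmonom I]}.
  elim: n => [|n IH]; first by rewrite expr0.
  rewrite exprS IH malgUM mulr1 expcmS; reflexivity.
have expcmE (v : I) n (u : I) : expcmn (ucm v) n u = (n * (v == u))%N.
  elim: n => [|n IH]; first exact: onecmE.
  by rewrite expcmS mulcmE ucmE IH mulSn.
have prodE (s : seq I) : uniq s -> exists nu : cmonom I,
    \prod_(v <- s) << ucm v >> ^+ mu v = << nu >> :> {malg A[cmonom I]}
    /\ forall u, nu u = (mu u * (u \in s))%N.
  elim: s => [|v s IH] => [_|/= /andP[vs /IH[nu [Enu nuE]]]].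
    exists (mone (s := cmonom I)); rewrite big_nil; split=> // u.
    by rewrite in_nil muln0; exact: cm1.
  exists (mulcm (expcmn (ucm v) (mu v)) nu); rewrite big_cons Enu expE malgUM mulr1.
  split; [reflexivity | move=> u]; rewrite mulcmE expcmE nuE inE eq_sym.
  case: (eqVneq u v) vs => [->|_ _] /=; last by rewrite muln0.
  by move/negPf->; rewrite muln0 addn0.
have [nu [-> nuE]] := prodE _ (fset_uniq (finsupp mu)); congr << _ >>.
apply/eqP/cmP => u; rewrite nuE -cmE_neq0.
by case: (mu u) => // n; rewrite muln1.
Qed.

Lemma malg_ind (T : {malg A[cmonom I]} -> Prop) :
  (forall c : A, T (mconst I c)) -> (forall v, T (mvar A v)) ->
  (forall f g, T f -> T g -> T (f + g)) -> (forall f g, T f -> T g -> T (f * g)) ->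
  forall f, T f.
Proof.
rewrite [mconst]unlock [mvar]unlock => TC TX TD TM f.
rewrite [f]monalgE; elim/big_rec: _ => [|mu g _ Tg].
  by rewrite -(monalgU0 (mone (s := cmonom I))); exact: TC.
apply: TD => //; rewrite malgUCX; apply: (TM) => //.
elim/big_rec: _ => [|v h _ Th]; first exact: TC.
by apply: (TM) => //; elim: (mu v) => [|n IH]; [exact: TC | rewrite exprS; apply: TM].
Qed.

Definition vars_in P f :=
  forall mu v, mu \in msupp f -> v \in finsupp mu -> P v.

Lemma vars_in_sub P Q f : (forall v, P v -> Q v) -> vars_in P f -> vars_in Q f.
Proof. by move=> PQ Pf mu v fmu muv; apply: PQ; apply: Pf muv. Qed.

Lemma vars_in0 P : vars_in P 0.
Proof. by move=> mu v; rewrite msupp0 in_fset0. Qed.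

Lemma vars_inD P f g : vars_in P f -> vars_in P g -> vars_in P (f + g).
Proof.
move=> Pf Pg mu v /(fsubsetP (msuppD_le _ _)); rewrite in_fsetU => /orP[]; [exact: Pf|exact: Pg].
Qed.

Lemma vars_in_sum P (J : eqType) (r : seq J) (C : pred J) F :
  (forall j, j \in r -> C j -> vars_in P (F j)) -> vars_in P (\sum_(j <- r | C j) F j).
Proof.
move=> H; rewrite big_seq_cond; elim/big_rec: _ => [|j f /andP[jr Cj]]; first exact: vars_in0.
by move=> Pf; apply: vars_inD => //; apply: H.
Qed.

Lemma vars_inU P (c : A) (mu : cmonom I) : (forall v, v \in finsupp mu -> P v) -> vars_in P << c *g mu >>.
Proof.
by move=> H nu v /(fsubsetP msuppU_le); rewrite in_fset1 => /eqP-> /H.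
Qed.

Lemma vars_inM P f g : vars_in P f -> vars_in P g -> vars_in P (f * g).
Proof.
move=> Pf Pg; rewrite malgME.
apply: vars_in_sum => mu fmu _; apply: vars_in_sum => nu gnu _.
apply: vars_inU => v; rewrite mdomD in_fsetU.
by case/orP; [exact: Pf | exact: Pg].
Qed.

Lemma aeval_eq_in (S : comNzRingType) (phi : A -> S) (w w' : I -> S) P f :
  vars_in P f -> (forall v, P v -> w v = w' v) -> aeval phi w f = aeval phi w' f.
Proof.
move=> Pf E; rewrite !aevalE; apply: eq_big_seq => mu fmu; congr (_ * _).
by apply: eq_big_seq => v muv; rewrite E //; apply: Pf muv.
Qed.

Lemma vars_in_divcm P f (mu : cmonom I) (c : A) (u : cmonom I) : vars_in P f -> mu \in msupp f ->
  vars_in P << c *g divcm mu u >>.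
Proof.
move=> Pf fmu; apply: vars_inU => v vin; apply: (Pf mu) => //.
move: vin; rewrite -!cmE_neq0 divcmE -!lt0n => H.
exact: (leq_trans H (leq_subr _ _)).
Qed.

End Vars.

Lemma aeval_comp (A S S' : comNzRingType) (phi : {rmorphism A -> S})
    (psi : {rmorphism S -> S'}) (w : I -> S) f :
  psi (aeval phi w f) = aeval (psi \o phi) (psi \o w) f.
Proof.
rewrite !aevalE rmorph_sum; apply: eq_bigr => mu _.
rewrite rmorphM rmorph_prod; congr (_ * _).
by apply: eq_bigr => v _; rewrite rmorphXn.
Qed.

End PolyEval.

Lemma addM_rearrange (B : comNzRingType) (dx x y dy vx vy : B) :
  dx * y + x * dy + (vx * y + x * vy) = (dx + vx) * y + x * (dy + vy).
Proof. by rewrite addrACA mulrDl mulrDr. Qed.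

Lemma sum_Leibniz (B : comNzRingType) (J : Type) (r : seq J) (F G H : J -> B) (x y : B) :
  (forall j, F j = G j * y + x * H j) ->
  \sum_(j <- r) F j = (\sum_(j <- r) G j) * y + x * \sum_(j <- r) H j.
Proof.
by move=> E; rewrite mulr_suml mulr_sumr -big_split; apply: eq_bigr.
Qed.

Lemma Leibniz_addr (B : comNzRingType) (D : B -> B) (x y z : B) :
  {morph D : x y / x + y} -> D (x * y) = D x * y + x * D y ->
  D (x * z) = D x * z + x * D z -> D (x * (y + z)) = D x * (y + z) + x * D (y + z).
Proof. by move=> DD Ey Ez; rewrite mulrDr !DD Ey Ez !mulrDr addrACA. Qed.

Lemma Leibniz_addl (B : comNzRingType) (D : B -> B) (x y z : B) :
  {morph D : x y / x + y} -> D (x * z) = D x * z + x * D z ->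
  D (y * z) = D y * z + y * D z -> D ((x + y) * z) = D (x + y) * z + (x + y) * D z.
Proof. by move=> DD Ex Ey; rewrite mulrDl !DD Ex Ey !mulrDl addrACA. Qed.

Lemma rmorph_derD (B S : comNzRingType) (F : {rmorphism B -> S}) (D : B -> B) (d : S -> S) x y :
  is_derivation D -> is_derivation d -> F (D x) = d (F x) -> F (D y) = d (F y) ->
  F (D (x + y)) = d (F (x + y)).
Proof. by move=> Dd dd Ex Ey; rewrite (derD Dd) !rmorphD (derD dd) Ex Ey. Qed.

Lemma rmorph_derM (B S : comNzRingType) (F : {rmorphism B -> S}) (D : B -> B) (d : S -> S) x y :
  is_derivation D -> is_derivation d -> F (D x) = d (F x) -> F (D y) = d (F y) ->
  F (D (x * y)) = d (F (x * y)).
Proof. by move=> Dd dd Ex Ey; rewrite (derM Dd) rmorphD !rmorphM (derM dd) Ex Ey. Qed.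

Lemma derCD (B : comNzRingType) (D E : B -> B) x y : is_derivation D -> is_derivation E ->
  D (E x) = E (D x) -> D (E y) = E (D y) -> D (E (x + y)) = E (D (x + y)).
Proof. by move=> Dd Ed Ex Ey; rewrite (derD Ed) !(derD Dd) (derD Ed) Ex Ey. Qed.

Lemma derCM (B : comNzRingType) (D E : B -> B) x y : is_derivation D -> is_derivation E ->
  D (E x) = E (D x) -> D (E y) = E (D y) -> D (E (x * y)) = E (D (x * y)).
Proof.
move=> Dd Ed Ex Ey.
rewrite (derM Ed) !(derD Dd) !(derM Dd) (derD Ed) !(derM Ed) Ex Ey -!addrA; congr (_ + _).
by rewrite addrCA.
Qed.

(** * Derivations of a polynomial ring *)

Section TwistedDerivation.
Variables (I : choiceType) (A : comNzRingType) (d : A -> A) (delta : I -> I).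
Hypothesis dder : is_derivation d.
Implicit Types (f g : {malg A[cmonom I]}) (c e : A) (mu nu : cmonom I).

(* dp_deriv for an arbitrary set I of indeterminates and an arbitrary map delta on it. *)
Definition mderiv f : {malg A[cmonom I]} :=
  \sum_(mu <- msupp f)
     (<< d f@_mu *g mu >> +
      \sum_(v <- finsupp mu) << f@_mu *+ mu v *g mulcm (divcm mu (ucm v)) (ucm (delta v)) >>).

Local Definition dvars (E : seq I) c mu : {malg A[cmonom I]} :=
  \sum_(v <- E) << c *+ mu v *g mulcm (divcm mu (ucm v)) (ucm (delta v)) >>.

Local Definition dterm c mu : {malg A[cmonom I]} := << d c *g mu >> + dvars (finsupp mu) c mu.

Local Lemma dvarsEw (E : {fset I}) c (mu : cmonom I) : (finsupp mu `<=` E)%fset ->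
  dvars (finsupp mu) c mu = dvars E c mu.
Proof.
move=> le; apply: big_fset_incl le _ => v _.
by rewrite -cmE_eq0 => /eqP->; rewrite mulr0n monalgU0.
Qed.

Local Lemma dtermD c e mu : dterm (c + e) mu = dterm c mu + dterm e mu.
Proof.
rewrite /dterm derD // monalgUD addrACA; congr (_ + _).
rewrite -big_split; apply: eq_bigr => v _ /=.
by rewrite mulrnDl monalgUD.
Qed.

Local Lemma dterm0 mu : dterm 0 mu = 0.
Proof. by apply: (addrI (dterm 0 mu)); rewrite -dtermD !addr0. Qed.

Local Lemma mderivEw (E : {fset cmonom I}) f : (msupp f `<=` E)%fset ->
  mderiv f = \sum_(mu <- E) dterm f@_mu mu.
Proof.
move=> le; rewrite [LHS](_ : _ = \sum_(mu <- msupp f) dterm f@_mu mu) //.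
by apply: big_fset_incl le _ => mu _ /mcoeff_outdom ->; exact: dterm0.
Qed.

Local Lemma mderivU c mu : mderiv << c *g mu >> = dterm c mu.
Proof. by rewrite (mderivEw msuppU_le) big_seq_fset1 mcoeffUU. Qed.

Local Lemma mderivD : {morph mderiv : f g / f + g}.
Proof.
move=> f g; pose E := (msupp f `|` msupp g)%fset.
rewrite !(mderivEw (E := E)) ?fsubsetUl ?fsubsetUr ?msuppD_le //.
by rewrite -big_split; apply: eq_bigr => mu _; rewrite mcoeffD dtermD.
Qed.

Local Lemma mderiv0 : mderiv (0 : {malg A[cmonom I]}) = 0.
Proof. by apply: (addrI (mderiv 0)); rewrite -mderivD !addr0. Qed.

Local Lemma dtermM c e (mu nu : cmonom I) :
  dterm (c * e) (mulcm mu nu)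
  = dterm c mu * << e *g nu >> + << c *g mu >> * dterm e nu.
Proof.
pose E := (finsupp mu `|` finsupp nu)%fset.
have leM : (finsupp (mulcm mu nu) `<=` E)%fset by rewrite mdomD.
suff EV : dvars (finsupp (mulcm mu nu)) (c * e) (mulcm mu nu) =
    dvars (finsupp mu) c mu * << e *g nu >> + << c *g mu >> * dvars (finsupp nu) e nu.
  rewrite /dterm EV (derM dder) monalgUD -(malgUM (d c) e mu nu) -(malgUM c (d e) mu nu).
  exact: addM_rearrange.
rewrite (dvarsEw _ leM) (dvarsEw _ (fsubsetUl (finsupp mu) (finsupp nu))).
rewrite (dvarsEw _ (fsubsetUr (finsupp mu) (finsupp nu))).
apply: sum_Leibniz => v.
rewrite mulcmE mulrnDr monalgUD; congr (_ + _).
  (* Division of monomials truncates at exponent 0, so it commutes with the product only if [v]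
     occurs in [mu]; otherwise the factor [mu v] kills the term. *)
  rewrite malgUM mulrnAl; case Ev: (mu v) => [|k]; first by rewrite !mulr0n !monalgU0.
  apply: malgU_ext => u; rewrite !(mulcmE, divcmE) ucmE.
  by case: eqP => [<-|_]; [rewrite Ev addSn !subn1 /= addnAC | rewrite !subn0 addnAC].
rewrite malgUM mulrnAr; case Ev: (nu v) => [|k]; first by rewrite !mulr0n !monalgU0.
apply: malgU_ext => u; rewrite !(mulcmE, divcmE) ucmE.
by case: eqP => [<-|_]; [rewrite Ev addnS !subn1 /= addnA | rewrite !subn0 addnA].
Qed.

Lemma mderiv_derivation : is_derivation mderiv.
Proof.
split=> [|f g]; first exact: mderivD.
elim/malg_addind: f => [|c mu|f f' IH IH'].
- by rewrite mul0r mderiv0 !mul0r addr0.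
- elim/malg_addind: g => [|e nu|g g' IH IH'].
  + by rewrite mulr0 mderiv0 !mulr0 addr0.
  + have:= dtermM c e mu nu.
    by rewrite -(mderivU (c * e)) -(mderivU c) -(mderivU e) -(malgUM c e).
  + exact: (Leibniz_addr mderivD IH IH').
- exact: (Leibniz_addl mderivD IH IH').
Qed.

Lemma mderivC c : mderiv (mconst I c) = mconst I (d c).
Proof.
rewrite [mconst]unlock mderivU /dterm /dvars mdom1 big_seq_fset0 addr0; reflexivity.
Qed.

Lemma mderivX v : mderiv (mvar A v) = mvar A (delta v).
Proof.
rewrite [mvar]unlock mderivU /dterm /dvars.
rewrite mdomU big_seq_fset1 (der1 dder) monalgU0 add0r cmUU mulr1n.
by apply: malgU_ext => u; rewrite mulcmE divcmE !ucmE subnn.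
Qed.

Lemma vars_in_mderiv (P Q : I -> Prop) f :
  (forall v, P v -> Q v /\ Q (delta v)) -> vars_in P f -> vars_in Q (mderiv f).
Proof.
move=> PQ Pf; apply: vars_in_sum => mu fmu _; apply: vars_inD.
  by apply: vars_inU => v /(Pf _ _ fmu) /PQ[].
apply: vars_in_sum => v muv _.
have [_ Qdv] := PQ _ (Pf _ _ fmu muv).
rewrite -[_ *+ _]mulr1 -malgUM; apply: vars_inM.
  by apply: vars_in_divcm fmu; apply: vars_in_sub Pf => u /PQ[].
by apply: vars_inU => u; rewrite mdomU in_fset1 => /eqP->.
Qed.

Lemma aeval_mderiv (S : comNzRingType) (d' : S -> S) (phi : {rmorphism A -> S})
    (w : I -> S) f :
  is_derivation d' -> (forall c, phi (d c) = d' (phi c)) ->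
  (forall v, w (delta v) = d' (w v)) ->
  aeval phi w (mderiv f) = d' (aeval phi w f).
Proof.
move=> d'der phid wd; elim/malg_ind: f => [c|v|f g Ef Eg|f g Ef Eg].
- by rewrite mderivC !aevalC.
- by rewrite mderivX !aevalX.
- exact: (rmorph_derD (F := aeval phi w) mderiv_derivation d'der Ef Eg).
- exact: (rmorph_derM (F := aeval phi w) mderiv_derivation d'der Ef Eg).
Qed.

End TwistedDerivation.

Lemma mderivCC (I : choiceType) (A : comNzRingType) (d d' : A -> A) (delta delta' : I -> I)
    (f : {malg A[cmonom I]}) :
  is_derivation d -> is_derivation d' -> (forall c, d (d' c) = d' (d c)) ->
  (forall v, delta (delta' v) = delta' (delta v)) ->
  mderiv d delta (mderiv d' delta' f) = mderiv d' delta' (mderiv d delta f).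
Proof.
move=> dder d'der ddC deltaC.
have Dder := mderiv_derivation delta dder; have D'der := mderiv_derivation delta' d'der.
elim/malg_ind: f => [c|v|f g Ef Eg|f g Ef Eg].
- by rewrite !mderivC // ddC.
- by rewrite !mderivX // deltaC.
- exact: (derCD Dder D'der Ef Eg).
- exact: (derCM Dder D'der Ef Eg).
Qed.

Definition dvarC n m : choiceType := dvar n m.
Definition vshift n m (i : 'I_m) (v : dvarC n m) : dvarC n m := (v.1, tshift v.2 i).

Section DPDeriv.
Variables (A : comNzRingType) (n m : nat) (d : 'I_m -> A -> A).
Hypothesis dcom : commuting_derivations d.
Local Notation DPA := {malg A[cmonom (dvarC n m)]}.
Implicit Types (f g : DPA) (i j : 'I_m).

Lemma dp_derivE i f : dp_deriv d i f = mderiv (d i) (vshift i) f.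
Proof. by []. Qed.

Lemma dp_deriv_derivation i : is_derivation (dp_deriv d i : DPA -> DPA).
Proof. by apply: mderiv_derivation; case: dcom. Qed.

Lemma dp_deriv_commuting : commuting_derivations (dp_deriv d : 'I_m -> DPA -> DPA).
Proof.
have [dder dC] := dcom; split; first exact: dp_deriv_derivation.
move=> i j f; apply: mderivCC => // v.
by rewrite /vshift /= tshiftC.
Qed.

Lemma dp_thetaS t i f : dp_theta d (tshift t i) f = dp_deriv d i (dp_theta d t f : DPA).
Proof. by apply: apply_thetaS; case: dp_deriv_commuting. Qed.

Lemma dp_theta0 f : dp_theta d (tzero m) f = f.
Proof. exact: apply_theta0. Qed.

Lemma aeval_theta (S : comNzRingType) (d' : 'I_m -> S -> S) (phi : {rmorphism A -> S})
    (w : dvarC n m -> S) t f :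
  commuting_derivations d' -> (forall i c, phi (d i c) = d' i (phi c)) ->
  (forall i v, w (vshift i v) = d' i (w v)) ->
  aeval phi w (dp_theta d t f) = apply_theta d' t (aeval phi w f).
Proof.
move=> [d'der d'C] phid wd; have [dder _] := dcom.
elim/Theta_ind: t => [|t i IH]; first by rewrite dp_theta0 apply_theta0.
by rewrite dp_thetaS apply_thetaS // dp_derivE (aeval_mderiv (dder i) _ (d'der i)) // IH.
Qed.

End DPDeriv.

Definition jet (S : comNzRingType) n m (d : 'I_m -> S -> S) (b : 'I_n -> S)
  (v : dvarC n m) : S := apply_theta d v.2 (b v.1).

Lemma jetS (S : comNzRingType) n m (d : 'I_m -> S -> S) (b : 'I_n -> S) i (v : dvarC n m) :
  commuting_derivations d -> jet d b (vshift i v) = d i (jet d b v).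
Proof. by case=> _ dC; rewrite /jet apply_thetaS. Qed.

Lemma dp_evalE (S : comNzRingType) n m (d : 'I_m -> S -> S) (b : 'I_n -> S)
    (f : {malg S[cmonom (dvarC n m)]}) :
  dp_eval d f b = aeval idfun (jet d b) f.
Proof. by rewrite aevalE. Qed.

Lemma dp_eval_map (A S : comNzRingType) n m (phi : A -> S) (d : 'I_m -> S -> S)
    (b : 'I_n -> S) (f : {malg A[cmonom (dvarC n m)]}) :
  dp_eval d (dp_map phi f) b = aeval phi (jet d b) f.
Proof.
rewrite [LHS](dp_evalE d b) [RHS]aevalE /dp_map rmorph_sum.
by apply: eq_bigr => mu _; exact: aevalU.
Qed.

Lemma aeval_ext (I : choiceType) (A S : comNzRingType) (phi phi' : A -> S) (w w' : I -> S) f :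
  phi =1 phi' -> w =1 w' -> aeval phi w f = aeval phi' w' f.
Proof.
move=> ephi ew; rewrite !aevalE; apply: eq_bigr => mu _.
by rewrite ephi; congr (_ * _); apply: eq_bigr => v _; rewrite ew.
Qed.

(** * Separants and leaders *)

HB.lock Definition pderiv (I : choiceType) (A : comNzRingType) (v : I) (f : {malg A[cmonom I]}) :
  {malg A[cmonom I]} :=
  \sum_(mu <- msupp f) << f@_mu *+ mu v *g divcm mu (ucm v) >>.

Section Partial.
Variables (I : choiceType) (A : comNzRingType).
Implicit Types (f : {malg A[cmonom I]}) (v : I).

Definition upd (S : Type) (w : I -> S) v (c : S) u := if u == v then c else w u.

Lemma vars_in_pderiv (P : I -> Prop) v f : vars_in P f -> vars_in P (pderiv v f).
Proof.
rewrite unlock => Pf; apply: vars_in_sum => mu fmu _; by apply: vars_in_divcm fmu.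
Qed.

Lemma cmval_upd_poly (w : I -> A) v (mu : cmonom I) : exists q : A,
  let W := upd (fun u => (w u)%:P) v 'X in
  cmval W mu = 'X^(mu v) * q%:P :> {poly A} /\
  cmval W (divcm mu (ucm v)) = 'X^((mu v).-1) * q%:P :> {poly A}.
Proof.
(* Adding [v] to the support lets its factor be split off even when it does not occur in [mu]. *)
pose E := (v |` finsupp mu)%fset.
exists (\prod_(u <- (E `\ v)%fset) w u ^+ mu u) => W.
have WE (nu : cmonom I) k : (finsupp nu `<=` E)%fset -> nu v = k ->
    (forall u, u != v -> nu u = mu u) ->
    cmval W nu = 'X^k * (\prod_(u <- (E `\ v)%fset) w u ^+ mu u)%:P.
  move=> le <- E'; rewrite (cmvalEw _ le) (big_fsetD1 v) ?fset1U1 //= {1}/W /upd eqxx.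
  congr (_ * _); rewrite rmorph_prod; apply: eq_big_seq => u; rewrite in_fsetD1 => /andP[uv _].
  by rewrite /W /upd (negPf uv) rmorphXn E'.
split; first by apply: WE => //; exact: fsubsetUr.
apply: WE => [|| u uv]; rewrite ?divcmE ?ucmE ?eqxx ?subn1 //; last first.
  by rewrite eq_sym (negPf uv) subn0.
apply/fsubsetP => u; rewrite !inE -!cmE_neq0 divcmE -!lt0n => H.
by rewrite (leq_trans H (leq_subr _ _)) orbT.
Qed.

(** Substituting 'X for [v] and freezing the other indeterminates leaves a univariate polynomial.
    With [v] the leader of [f], its derivative computes the separant, which is how Hensel's lemma
    becomes applicable. *)
Lemma aeval_upd_poly (w : I -> A) v f : exists p : {poly A}, forall c,
  p.[c] = aeval idfun (upd w v c) f /\ p^`().[c] = aeval idfun (upd w v c) (pderiv v f).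
Proof.
pose W : I -> {poly A} := upd (fun u => (w u)%:P) v 'X.
have hornerW c g : (aeval polyC W g).[c] = aeval idfun (upd w v c) g.
  rewrite -[LHS]/(horner_eval c _) aeval_comp; apply: aeval_ext => [x|u] /=.
    by rewrite /horner_eval hornerC.
  by rewrite /horner_eval /W /upd; case: eqP => _; rewrite ?hornerX ?hornerC.
exists (aeval polyC W f) => c; split; first exact: hornerW.
rewrite -hornerW; congr _.[c].
rewrite [pderiv]unlock [LHS](congr1 _ (aevalE _ _ _)) [LHS]raddf_sum [RHS]rmorph_sum.
apply: eq_bigr => mu _; rewrite /= aevalU.
have [q [-> ->]] := cmval_upd_poly w v mu.
rewrite derivM derivC mul0r add0r derivM derivC mulr0 addr0 derivXn raddfMn.
by rewrite mulrnAl mulrnAr [RHS]mulrnAl.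
Qed.

End Partial.

Section Leader.
Variables (A : comNzRingType) (m : nat).
Local Notation DPA := {malg A[cmonom (dvarC 1 m)]}.
Implicit Types (f g : DPA) (t u : Theta m).

Definition tvars (P : Theta m -> Prop) f := vars_in (fun v : dvarC 1 m => P v.2) f.

Lemma appearsP t f :
  reflect (exists2 mu, mu \in msupp f & (xv t : dvarC 1 m) \in finsupp mu) (appears t f).
Proof.
apply: (iffP flattenP) => [[s /mapP[mu fmu ->] /mapP[v vmu ->]]|[mu fmu tmu]].
  exists mu => //; rewrite /xv; suff -> : (ord0, v.2) = v by [].
  by case: v {vmu} => i t' /=; rewrite (ord1 i).
exists [seq v.2 | v <- finsupp mu]; apply/mapP; first by exists mu.
by exists (xv t).
Qed.

Lemma tvarsP P f : tvars P f <-> forall t, appears t f -> P t.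
Proof.
split=> [Pf t /appearsP[mu fmu tmu]|Pf mu v fmu vmu]; first exact: (Pf _ _ fmu tmu).
apply: Pf; apply/appearsP; exists mu => //.
by case: v vmu => i t; rewrite /xv (ord1 i).
Qed.

Lemma leader_foldr (s : seq (Theta m)) t0 :
  let r := foldr (fun t acc => if rank_lt acc t then t else acc) t0 s in
  r \in t0 :: s /\ forall t, t \in t0 :: s -> ~~ rank_lt r t.
Proof.
elim: s => [|t s [IH1 IH2]] /=.
  by rewrite inE; split=> // t; rewrite inE => /eqP->; rewrite rank_lt_irr.
set r := foldr _ _ _ in IH1 IH2 *; case: ifP => rt; split.
- by rewrite !inE eqxx orbT.
- move=> u; rewrite !inE orbCA => /orP[/eqP->|uin]; first by rewrite rank_lt_irr.
  by apply: contra (IH2 u uin) => /(rank_lt_trans rt).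
- by move: IH1; rewrite !inE => /orP[->|->]; rewrite ?orbT.
- move=> u; rewrite !inE orbCA => /orP[/eqP->|]; [by rewrite rt | exact: IH2].
Qed.

Lemma leader_appears f : ~~ dp_const f -> appears (leader f) f.
Proof.
rewrite /dp_const /appears /leader.
case E: (dp_vars f) => [|t s] // _; rewrite -E.
have [+ _] := leader_foldr (dp_vars f) (head [ffun => 0%N] (dp_vars f)).
by rewrite inE => /orP[/eqP->|//]; rewrite E mem_head.
Qed.

Lemma leader_max t f : appears t f -> ~~ rank_lt (leader f) t.
Proof.
move=> tf; have [_ H] := leader_foldr (dp_vars f) (head [ffun => 0%N] (dp_vars f)).
by apply: H; rewrite inE [t \in _]tf orbT.
Qed.

Definition rank_le t u := t = u \/ rank_lt t u.

Lemma tvars_leader f : tvars (fun t => rank_le t (leader f)) f.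
Proof.
apply/tvarsP => t /leader_max ntf; case: (eqVneq t (leader f)) => [->|ne]; first by left.
by right; move: (rank_lt_total ne); rewrite (negPf ntf) orbF.
Qed.

Lemma separantE f : separant f = pderiv (xv (leader f) : dvarC 1 m) f.
Proof. by rewrite unlock. Qed.

Lemma tvars_separant f : tvars (fun t => rank_le t (leader f)) (separant f).
Proof. rewrite separantE; apply: vars_in_pderiv; exact: tvars_leader. Qed.

End Leader.

Lemma sum_split_mul (B : comNzRingType) (J : eqType) (r : seq J) (a c e s : J -> B) (x : B) :
  (forall j, j \in r -> c j = s j * x + e j) ->
  \sum_(j <- r) (a j + c j) = (\sum_(j <- r) s j) * x + \sum_(j <- r) (a j + e j).
Proof.
move=> E; rewrite mulr_suml -big_split; apply: eq_big_seq => j jr.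
by rewrite E // addrCA.
Qed.

Lemma der_mul_add (B : comNzRingType) (D : B -> B) (s x g : B) : is_derivation D ->
  D (s * x + g) = s * D x + (D s * x + D g).
Proof. by move=> Dd; rewrite (derD Dd) (derM Dd) addrCA addrA addrC addrCA. Qed.

(** The terms of the derivative at [v] add up to the partial derivative times [delta v]; all others
    involve only some u satisfying P, or [delta u] with u different from [v]. *)
Lemma mderiv_split (I : choiceType) (A : comNzRingType) (d : A -> A) (delta : I -> I)
    (P Q : I -> Prop) v (f : {malg A[cmonom I]}) :
  vars_in P f -> (forall u, P u -> Q u) -> (forall u, P u -> u != v -> Q (delta u)) ->
  exists g, mderiv d delta f = pderiv v f * mvar A (delta v) + g /\ vars_in Q g.
Proof.
move=> Pf PQ PQd.
pose T mu u : {malg A[cmonom I]} := << f@_mu *+ mu u *g mulcm (divcm mu (ucm u)) (ucm (delta u)) >>.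
exists (\sum_(mu <- msupp f) (<< d f@_mu *g mu >> + \sum_(u <- finsupp mu | u != v) T mu u)); split.
  rewrite [pderiv]unlock; apply: sum_split_mul => mu fmu.
  have -> : << f@_mu *+ mu v *g divcm mu (ucm v) >> * mvar A (delta v) = T mu v.
    by rewrite [mvar]unlock malgUM mulr1.
  case: (boolP (v \in finsupp mu)) => vmu; first by rewrite (bigD1_seq v) ?fset_uniq.
  have /eqP E : mu v == 0%N by rewrite cmE_eq0.
  have -> : T mu v = 0 by rewrite /T E mulr0n monalgU0.
  rewrite add0r [LHS]big_seq_cond [RHS]big_seq_cond; apply: eq_bigl => u.
  by case: (boolP (u \in finsupp mu)) => //= umu; case: eqP umu vmu => // -> ->.
apply: vars_in_sum => mu fmu _; apply: vars_inD.
  by apply: vars_inU => u umu; apply: PQ; apply: (Pf _ _ fmu umu).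
apply: vars_in_sum => u umu uv; have Pu := Pf _ _ fmu umu.
rewrite /T -[_ *+ _]mulr1 -malgUM; apply: vars_inM.
  by apply: vars_in_divcm fmu; apply: vars_in_sub Pf.
by apply: vars_inU => u'; rewrite mdomU in_fset1 => /eqP->; exact: PQd.
Qed.

Section ThetaSplit.
Variables (A : comNzRingType) (m : nat) (d : 'I_m -> A -> A).
Hypothesis dcom : commuting_derivations d.
Local Notation DPA := {malg A[cmonom (dvarC 1 m)]}.
Implicit Types (f g : DPA) (t u : Theta m).

Definition tvar t : DPA := mvar A (xv t : dvarC 1 m).

Lemma rank_le_trans t u i : rank_le t u -> rank_lt t (tshift u i).
Proof.
by case=> [->|tu]; [exact: rank_lt_tshift | exact: rank_lt_trans tu (rank_lt_tshift _ _)].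
Qed.

Lemma tvars_deriv P Q f i : (forall t, P t -> Q t /\ Q (tshift t i)) ->
  tvars P f -> tvars Q (dp_deriv d i f).
Proof. by move=> PQ; apply: vars_in_mderiv => v; apply: PQ. Qed.

Lemma dp_deriv_split f i : exists g,
  dp_deriv d i f = separant f * tvar (tshift (leader f) i) + g /\
  tvars (fun t => rank_lt t (tshift (leader f) i)) g.
Proof.
have PQ (u : dvarC 1 m) : rank_le u.2 (leader f) -> rank_lt u.2 (tshift (leader f) i).
  exact: rank_le_trans.
have PQd (u : dvarC 1 m) : rank_le u.2 (leader f) -> u != xv (leader f) ->
    rank_lt (vshift i u).2 (tshift (leader f) i).
  move=> Pu ne; rewrite rank_lt_tshift2; case: Pu => // E; case/eqP: ne.
  by case: u E => j t /= ->; rewrite /xv (ord1 j).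
have [g [E Qg]] := mderiv_split (d i) (@tvars_leader _ _ f) PQ PQd.
exists g; split; last exact: Qg.
rewrite separantE; exact: E.
Qed.

(** The induction starts at a first derivative, since [f] itself need not be linear in its leader.
    Differentiating s * u + g once more gives s times the shifted indeterminate, and D s * u + D g
    stays lower because shifts preserve the ranking. *)
Lemma dp_theta_split f t : t != tzero m -> exists g,
  dp_theta d t f = separant f * tvar (tadd t (leader f)) + g /\
  tvars (fun u => rank_lt u (tadd t (leader f))) g.
Proof.
elim/Theta_ind: t => [|t i IH]; [by rewrite eqxx | move=> _].
rewrite dp_thetaS // tshift_addl; case: (eqVneq t (tzero m)) => [->|t0].
  by rewrite dp_theta0 t0add; exact: dp_deriv_split.
have [g [-> gt]] := IH t0.
set u := tadd t (leader f) in gt *.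
have lu : rank_lt (leader f) u by apply: rank_lt_addl.
have Dd : is_derivation (dp_deriv d i : DPA -> DPA) by exact: dp_deriv_derivation.
exists (dp_deriv d i (separant f) * tvar u + dp_deriv d i g); split.
  have EX : dp_deriv d i (tvar u) = tvar (tshift u i).
    by apply: (mderivX (vshift i)); case: dcom.
  have := der_mul_add (separant f) (tvar u) g Dd; rewrite -> EX; exact.
apply: vars_inD; first apply: vars_inM.
- apply: (tvars_deriv (P := fun t => rank_le t (leader f)) (Q := fun t => rank_lt t (tshift u i))) => [w wl|]; last exact: tvars_separant.
  have lw := rank_lt_trans lu (rank_lt_tshift u i).
  split; first by case: wl => [->//|/rank_lt_trans]; apply.
  by rewrite rank_lt_tshift2; case: wl => [->//|/rank_lt_trans]; apply.
- rewrite /tvar unlock; apply: vars_inU => w; rewrite mdomU in_fset1 => /eqP->.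
  exact: rank_lt_tshift.
- apply: (tvars_deriv (P := fun t => rank_lt t u) (Q := fun t => rank_lt t (tshift u i))) gt => w wu.
  by rewrite rank_lt_tshift2; split=> //; apply: rank_lt_trans wu (rank_lt_tshift _ _).
Qed.

Lemma tvars_theta f t : tvars (fun u => rank_le u (tadd t (leader f))) (dp_theta d t f).
Proof.
case: (eqVneq t (tzero m)) => [->|t0].
  by rewrite dp_theta0 t0add; exact: tvars_leader.
have [g [-> gt]] := dp_theta_split f t0.
have lu : rank_lt (leader f) (tadd t (leader f)) by apply: rank_lt_addl.
apply: vars_inD; first apply: vars_inM.
- apply: (vars_in_sub (P := fun w : dvarC 1 m => rank_le w.2 (leader f))) => [w wl|]; last exact: tvars_separant.
  right.
  by case: wl => [->//|/rank_lt_trans]; apply.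
- by rewrite /tvar unlock; apply: vars_inU => w; rewrite mdomU in_fset1 => /eqP->; left.
- by apply: (vars_in_sub (P := fun w : dvarC 1 m => rank_lt w.2 (tadd t (leader f)))) gt => w wu; right.
Qed.

End ThetaSplit.

(** * The differential field of a prime differential ideal *)

(** The commutator of two derivations is a derivation, so it sends b y to its value at b times y
    plus b times its value at y. With [b] a denominator of [y], commutation passes from the ring to
    its fractions. *)
Lemma derC_div (B : comNzRingType) (D E : B -> B) b y : is_derivation D -> is_derivation E ->
  D (E b) = E (D b) -> D (E (b * y)) = E (D (b * y)) -> b * D (E y) = b * E (D y).
Proof.
move=> Dd Ed Cb; rewrite (derM Dd) (derM Ed) !(derD Dd, derD Ed) !(derM Dd, derM Ed) Cb.
by rewrite -!addrA => /addrI; rewrite addrCA => /addrI /addrI.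
Qed.

Section FractionDerivation.
Variables (D : comNzRingType) (K : fieldType) (j : {rmorphism D -> K}).
Hypothesis j0 : forall x, j x = 0 -> x = 0.
Hypothesis jfrac : forall x, exists ab : D * D, ab.2 <> 0 /\ x = j ab.1 / j ab.2.

Definition frac_der (d : D -> D) (x : K) : K :=
  let: (a, b) := sval (cid (jfrac x)) in j (d a * b - a * d b) / j b ^+ 2.

Section One.
Variable d : D -> D.
Hypothesis dder : is_derivation d.

Lemma frac_derE a b : b <> 0 ->
  frac_der d (j a / j b) = j (d a * b - a * d b) / j b ^+ 2.
Proof.
move=> b0; rewrite /frac_der.
case: (cid (jfrac _)) => -[a' b'] /= [b'0 E].
have jn0 (x : D) : x <> 0 -> j x != 0 by move=> x0; apply/eqP => /j0.
have [jb jb'] := (jn0 _ b0, jn0 _ b'0).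
have E1 : a * b' = a' * b.
  apply/eqP; rewrite -subr_eq0; apply/eqP/j0; rewrite rmorphB !rmorphM.
  by move/(congr1 (fun x => x * j b * j b')): E; rewrite divfK // mulrAC divfK // => ->; rewrite subrr.
have E2 : d a * b' + a * d b' = d a' * b + a' * d b by rewrite -!(derM dder) E1.
apply/eqP; rewrite eqr_div ?expf_neq0 // -!(rmorphXn j) -!(rmorphM j); apply/eqP; congr (j _).
(* The two cross products differ by a combination of a b' - a' b and of its derivative, both of
   which vanish. *)
have -> : (d a' * b' - a' * d b') * b ^+ 2 = (d a * b - a * d b) * b' ^+ 2
   - b * b' * ((d a * b' + a * d b') - (d a' * b + a' * d b))
   + (d b * b' + d b' * b) * (a * b' - a' * b) by ring.
by rewrite E2 E1 !subrr !mulr0 subr0 addr0.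
Qed.

Lemma frac_der_ext a : frac_der d (j a) = j (d a).
Proof.
have := @frac_derE a 1 (fun e => elimN eqP (oner_neq0 D) e).
by rewrite rmorph1 divr1 (der1 dder) !mulr1 mulr0 subr0 expr1n divr1.
Qed.

Lemma frac_der_derivation : is_derivation (frac_der d).
Proof.
have jn0 (x : D) : x <> 0 -> j x != 0 by move=> x0; apply/eqP => /j0.
have nzM (x y : D) : x <> 0 -> y <> 0 -> x * y <> 0.
  by move=> x0 y0 E; have := mulf_neq0 (jn0 _ x0) (jn0 _ y0); rewrite -rmorphM E rmorph0 eqxx.
split=> x y; have [[a b] /= [b0 ->]] := jfrac x; have [[c e] /= [e0 ->]] := jfrac y;
    have [jb je] := (jn0 _ b0, jn0 _ e0).
  have -> : j a / j b + j c / j e = j (a * e + c * b) / j (b * e).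
    by rewrite addf_div // !(rmorphD, rmorphM).
  rewrite !frac_derE //; last exact: nzM.
  rewrite !(derD dder, derM dder) !(rmorphB, rmorphD, rmorphM).
  by field; rewrite jb je.
have -> : j a / j b * (j c / j e) = j (a * c) / j (b * e).
  by rewrite mulf_div !rmorphM.
rewrite !frac_derE //; last exact: nzM.
rewrite !(derD dder, derM dder) !(rmorphB, rmorphD, rmorphM).
by field; rewrite jb je.
Qed.

End One.

Lemma frac_derC (d d' : D -> D) x : is_derivation d -> is_derivation d' ->
  (forall a, d (d' a) = d' (d a)) -> frac_der d (frac_der d' x) = frac_der d' (frac_der d x).
Proof.
move=> dder d'der dC.
have [Fd Fd'] := (frac_der_derivation dder, frac_der_derivation d'der).
have [[a b] /= [b0 ->]] := jfrac x; set y := j a / j b.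
have jb : j b != 0 by apply/eqP => /j0.
have ya : j b * y = j a by rewrite /y mulrCA divff // mulr1.
apply: (mulfI jb).
apply: (derC_div Fd Fd'); last by rewrite ya !frac_der_ext ?dC.
by rewrite !frac_der_ext ?dC.
Qed.

End FractionDerivation.

Section ClassicalDomain.
Variable D : comNzRingType.
Hypothesis Ddom : forall x y : D, x * y = 0 -> (x == 0) || (y == 0).

(** A copy of D that carries the absence of zero divisors as a parameter, so that the structure of
    an integral domain, with classically chosen inverses, can be attached to it. *)
Definition cdomain (H : forall x y : D, x * y = 0 -> (x == 0) || (y == 0)) : Type := D.
Local Notation T := (cdomain Ddom).
HB.instance Definition _ := GRing.ComNzRing.copy T D.

Definition cd_unit : pred T := fun x => `[< exists y : T, y * x = 1 >].
Definition cd_inv (x : T) : T :=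
  if pselect (exists y : T, y * x = 1) is left H then projT1 (cid H) else x.

Lemma cd_mulVr : {in cd_unit, left_inverse 1 cd_inv *%R}.
Proof.
move=> x /asboolP H; rewrite /cd_inv; case: pselect => // H'.
exact: (projT2 (cid H')).
Qed.

Lemma cd_unitP (x y : T) : y * x = 1 -> x \in cd_unit.
Proof. by move=> E; apply/asboolP; exists y. Qed.

Lemma cd_inv_out : {in [predC cd_unit], cd_inv =1 id}.
Proof. by move=> x /negP H; rewrite /cd_inv; case: pselect => // H'; case: H; apply/asboolP. Qed.

HB.instance Definition _ := GRing.ComNzRing_hasMulInverse.Build T cd_mulVr cd_unitP cd_inv_out.
HB.instance Definition _ := GRing.ComUnitRing_isIntegral.Build T Ddom.

Lemma fraction_field_of : exists (K : fieldType) (j : {rmorphism D -> K}),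
  (forall x, j x = 0 -> x = 0) /\ (forall x, exists ab : D * D, ab.2 <> 0 /\ x = j ab.1 / j ab.2).
Proof.
pose j : {rmorphism T -> {fraction T}} := @FracField.tofrac T.
exists {fraction T}, j; split; first by move=> x /eqP; rewrite tofrac_eq0 => /eqP.
elim/quotW => x; exists (x.1, x.2); split; first exact/eqP/denom_ratioP.
have x2 := denom_ratioP x.
have jx2 : j x.2 != 0 by rewrite tofrac_eq0.
apply: (canRL (mulfK jx2)).
rewrite /j /= !piE.
apply/eqmodP; rewrite /= /FracField.equivf /= /FracField.mulf !numden_Ratio ?mulr1 ?oner_neq0 //.
by rewrite mulrC.
Qed.

End ClassicalDomain.

Section ResidueField.
Variables (A : comNzRingType) (P : A -> Prop).
Hypotheses (Pideal : is_ideal P) (P1 : ~ P 1).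
Hypothesis Pprime : forall x y, P (x * y) -> P x \/ P y.

Definition prime_pred (pi : is_ideal P) (p1 : ~ P 1)
  (pp : forall x y, P (x * y) -> P x \/ P y) : {pred A} := fun x => `[< P x >].

Lemma prime_pred_closed : idealr_closed (prime_pred Pideal P1 Pprime).
Proof.
have [P0 [PD PM]] := Pideal; split; [exact/asboolP | exact/asboolPn |].
by move=> a x y /asboolP Px /asboolP Py; apply/asboolP/PD; [exact: PM|].
Qed.

Lemma prime_pred_prime : prime_idealr_closed (prime_pred Pideal P1 Pprime).
Proof.
move=> x y /asboolP /Pprime[Px|Py]; apply/orP; [left|right]; exact/asboolP.
Qed.

HB.instance Definition _ := isIdealr.Build A (prime_pred Pideal P1 Pprime) prime_pred_closed.
HB.instance Definition _ :=
  isPrimeIdealrClosed.Build A (prime_pred Pideal P1 Pprime) prime_pred_prime.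

Lemma domain_quotient : exists (D : comNzRingType) (pi : {rmorphism A -> D}),
  [/\ forall x y : D, x * y = 0 -> (x == 0) || (y == 0), forall x, pi x = 0 <-> P x
    & forall y, exists x, pi x = y].
Proof.
pose I : prime_idealr A := prime_pred Pideal P1 Pprime.
pose pi : {rmorphism A -> {ideal_quot I}} := \pi_{ideal_quot I}%qT.
exists {ideal_quot I}, pi; split.
- exact: Quotient.rquot_IdomainAxiom.
- move=> x; rewrite -(rmorph0 pi); split=> [/eqP|Px].
    by rewrite -Quotient.idealrBE subr0 => /asboolP.
  by apply/eqP; rewrite -Quotient.idealrBE subr0; apply/asboolP.
- by move=> y; exists (repr y); rewrite /pi /= reprK.
Qed.

End ResidueField.

(** Serves twice: for the maximal ideal of R, to produce residues, and for the zero ideal of H(L).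
    The derivations descend to the quotient because P is stable under them, and extend to fractions
    by the quotient rule. *)
Lemma prime_residue_field (A : comNzRingType) m (d : 'I_m -> A -> A) (P : A -> Prop) :
  commuting_derivations d -> is_ideal P -> ~ P 1 ->
  (forall x y, P (x * y) -> P x \/ P y) -> (forall i x, P x -> P (d i x)) ->
  exists (K : fieldType) (dK : 'I_m -> K -> K) (j : {rmorphism A -> K}),
    [/\ commuting_derivations dK, forall i x, j (d i x) = dK i (j x)
      & forall x, j x = 0 <-> P x].
Proof.
move=> [dder dC] Pideal P1 Pprime Pd.
have [D [pi [Ddom piP pi_surj]]] := domain_quotient Pideal P1 Pprime.
have [K [j [j0 jfrac]]] := fraction_field_of Ddom.
pose s y := sval (cid (pi_surj y)).
have sK y : pi (s y) = y by rewrite /s; case: cid.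
pose dD i y := pi (d i (s y)).
have piE x y : pi x = pi y <-> P (x - y).
  by rewrite -piP rmorphB; split=> [->|/subr0_eq//]; rewrite subrr.
have dDE i x : dD i (pi x) = pi (d i x).
  by apply/piE; rewrite -(derB (dder i)); apply: Pd; apply/piE; rewrite sK.
have dDder i : is_derivation (dD i).
  split=> x y; rewrite -[x]sK -[y]sK.
    by rewrite -rmorphD !dDE (derD (dder i)) rmorphD.
  by rewrite -rmorphM !dDE (derM (dder i)) rmorphD !rmorphM.
have dDC i k y : dD i (dD k y) = dD k (dD i y) by rewrite -[y]sK !dDE dC.
exists K, (fun i => frac_der jfrac (dD i)), (j \o pi); split.
- split=> [i|i k x]; first exact: frac_der_derivation.
  exact: frac_derC.
- by move=> i x; rewrite /= frac_der_ext // dDE.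
- by move=> x; rewrite /= -piP; split=> [/j0//|->]; rewrite rmorph0.
Qed.

(** * Hurwitz series *)

Section Words.
Variable m : nat.
Implicit Types (t u : Theta m) (w : seq 'I_m).

(** Exponents are also written as words in the derivations: along a word the Leibniz rule is a plain
    recursion, free of binomial coefficients. *)
Definition wt w : Theta m := foldr (fun i t => tshift t i) (tzero m) w.

Lemma tshift_inj i : injective (fun t => tshift t i).
Proof.
move=> t u /ffunP E; apply/ffunP => j.
by have := E j; rewrite !ffunE => /addIn.
Qed.

Lemma wt_surj t : exists w, wt w = t.
Proof. by elim/Theta_ind: t => [|t i [w <-]]; [exists [::] | exists (i :: w)]. Qed.

Definition word t : seq 'I_m := sval (cid (wt_surj t)).

Lemma wordK t : wt (word t) = t.
Proof. by rewrite /word; case: cid. Qed.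

Lemma tdeg_wt w : tdeg (wt w) = size w.
Proof.
elim: w => [|i w IH] /=; first by apply/eqP; rewrite tdeg_eq0.
by rewrite tdeg_shift IH.
Qed.

Lemma wt_mem i w t : wt w = tshift t i -> exists w1 w2, w = w1 ++ i :: w2.
Proof.
move=> E; suff /splitPr[w1 w2] : i \in w by exists w1, w2.
have : (0 < wt w i)%N by rewrite E ffunE eqxx addn1.
elim: w {E} => [|j w IH] /=; first by rewrite ffunE.
by rewrite ffunE inE eq_sym; case: eqP => //= _; rewrite addn0.
Qed.

Lemma wt_move i w1 w2 : wt (w1 ++ i :: w2) = tshift (wt (w1 ++ w2)) i.
Proof. by elim: w1 => //= j w1 ->; rewrite tshiftC. Qed.

End Words.

(* The coefficient at t stands for the value at the origin of the t-th derivative. *)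
Definition hurw (m : nat) (A : comNzRingType) : Type := Theta m -> A.

Section Hurwitz.
Variables (m : nat) (A : comNzRingType).
Implicit Types (f g h : Theta m -> A) (t u : Theta m) (w : seq 'I_m) (i j : 'I_m).

Definition hshift i f : Theta m -> A := fun t => f (tshift t i).

(* The Leibniz rule along the word w. *)
Fixpoint hmulw f g w : A :=
  if w is i :: w' then hmulw (hshift i f) g w' + hmulw f (hshift i g) w'
  else f (tzero m) * g (tzero m).

Lemma hshiftC i j f : hshift i (hshift j f) = hshift j (hshift i f).
Proof. by apply/funext => t; rewrite /hshift tshiftC. Qed.

Lemma hmulw_move f g i w1 w2 : hmulw f g (w1 ++ i :: w2) = hmulw f g (i :: w1 ++ w2).
Proof.
elim: w1 f g => //= j w1 IH f g; rewrite !IH /= !(hshiftC i j).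
by rewrite -!addrA; congr (_ + _); rewrite addrCA.
Qed.

(** Shifts commute, so a letter can be moved to the front of a word without changing the expansion.
    The product of series is thus independent of the choice made by [word]. *)
Lemma hmulw_wt f g w w' : wt w = wt w' -> hmulw f g w = hmulw f g w'.
Proof.
elim: w w' f g => [|i w IH] w' f g E.
  have /size0nil -> // : size w' = 0%N.
  by rewrite -tdeg_wt -E tdeg_wt.
have [w1 [w2 e]] := wt_mem (esym E).
rewrite e hmulw_move /=; move: E; rewrite e wt_move /= => /tshift_inj E.
by rewrite (IH _ _ _ E) (IH _ _ _ E).
Qed.

Definition hmul f g : Theta m -> A := fun t => hmulw f g (word t).

Lemma hmulE f g w : hmul f g (wt w) = hmulw f g w.
Proof. by apply: hmulw_wt; rewrite wordK. Qed.

Lemma hshift_mul i f g :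
  hshift i (hmul f g) = fun t => hmul (hshift i f) g t + hmul f (hshift i g) t.
Proof.
apply/funext => t; rewrite -(wordK t) /hshift !hmulE.
by rewrite -[tshift _ _]/(wt (i :: word t)) hmulE.
Qed.

Lemma hmulwDl f f' g w : hmulw (fun t => f t + f' t) g w = hmulw f g w + hmulw f' g w.
Proof.
elim: w f f' g => [|i w IH] f f' g /=; first by rewrite mulrDl.
rewrite -[hshift i (fun t => _)]/(fun t => hshift i f t + hshift i f' t) !IH.
by rewrite addrACA.
Qed.

Lemma hmulwC f g w : hmulw f g w = hmulw g f w.
Proof.
elim: w f g => [|i w IH] f g /=; first by rewrite mulrC.
by rewrite addrC (IH f) (IH _ g).
Qed.

Lemma hmulwA f g h w : hmulw (hmul f g) h w = hmulw f (hmul g h) w.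
Proof.
elim: w f g h => [|i w IH] f g h /=.
  by rewrite -[tzero m]/(wt [::]) !hmulE /= mulrA.
by rewrite !hshift_mul hmulwDl !(hmulwC f) hmulwDl !(hmulwC _ f) !IH addrA.
Qed.

Lemma hmulw_zero f g w :
  (forall t u, tadd t u = wt w -> f t = 0 \/ g u = 0) -> hmulw f g w = 0.
Proof.
elim: w f g => [|i w IH] f g H /=.
  by case: (H (tzero m) (tzero m)); rewrite ?tadd0 // => ->; rewrite ?mul0r ?mulr0.
rewrite !IH ?addr0 // => t u E; [apply: (H t (tshift u i)) | apply: (H (tshift t i) u)].
  by rewrite tshift_addr E.
by rewrite tshift_addl E.
Qed.

Definition hone : Theta m -> A := fun t => (t == tzero m)%:R.

Lemma hmulw1 g w : hmulw hone g w = g (wt w).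
Proof.
elim: w g => [|i w IH] g /=; first by rewrite /hone eqxx mul1r.
rewrite IH hmulw_zero ?add0r // => t u _; left.
by rewrite /hshift /hone (negPf (tshift_neq0 t i)).
Qed.

End Hurwitz.

Section HurwitzRing.
Variables (m : nat) (A : comNzRingType).
Local Notation H := (hurw m A).

HB.instance Definition _ := gen_eqMixin H.
HB.instance Definition _ := gen_choiceMixin H.

Let hzero : H := fun _ => 0.
Let hopp (f : H) : H := fun t => - f t.
Let hadd (f g : H) : H := fun t => f t + g t.

Lemma haddA : associative hadd.
Proof. by move=> f g h; apply/funext => t; rewrite /hadd addrA. Qed.
Lemma haddC : commutative hadd.
Proof. by move=> f g; apply/funext => t; rewrite /hadd addrC. Qed.
Lemma hadd0 : left_id hzero hadd.
Proof. by move=> f; apply/funext => t; rewrite /hadd add0r. Qed.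
Lemma haddN : left_inverse hzero hopp hadd.
Proof. by move=> f; apply/funext => t; rewrite /hadd addNr. Qed.

HB.instance Definition _ := GRing.isZmodule.Build H haddA haddC hadd0 haddN.

Lemma hmulA : associative (@hmul m A : H -> H -> H).
Proof. by move=> f g h; apply/funext => t; rewrite -(wordK t) !hmulE hmulwA. Qed.
Lemma hmulC : commutative (@hmul m A : H -> H -> H).
Proof. by move=> f g; apply/funext => t; rewrite /hmul hmulwC. Qed.
Lemma hmul1 : left_id (@hone m A : H) (@hmul m A).
Proof. by move=> f; apply/funext => t; rewrite -(wordK t) hmulE hmulw1. Qed.
Lemma hmulDl : left_distributive (@hmul m A : H -> H -> H) +%R.
Proof. by move=> f g h; apply/funext => t; rewrite /hmul hmulwDl. Qed.
Lemma hone_neq0 : (@hone m A : H) != 0.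
Proof.
by apply/eqP => /(congr1 (@^~ (tzero m))); rewrite /hone eqxx => /eqP; rewrite oner_eq0.
Qed.

HB.instance Definition _ :=
  GRing.Zmodule_isComNzRing.Build H hmulA hmulC hmul1 hmulDl hone_neq0.

Implicit Types (f g : H) (t : Theta m) (w : seq 'I_m).

Lemma haddE f g t : (f + g) t = f t + g t. Proof. by []. Qed.
Lemma hsubE f g t : (f - g) t = f t - g t. Proof. by []. Qed.
Lemma hzeroE t : (0 : H) t = 0. Proof. by []. Qed.
Lemma hprodE f g w : (f * g) (wt w) = hmulw f g w. Proof. exact: hmulE. Qed.

Lemma hsumE (J : Type) (r : seq J) (P : pred J) (F : J -> H) t :
  (\sum_(j <- r | P j) F j) t = \sum_(j <- r | P j) F j t.
Proof. exact: (big_morph (fun f : H => f t) (fun f g => haddE f g t) (hzeroE t)). Qed.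

Definition hder (i : 'I_m) : H -> H := @hshift m A i.

Lemma hder_commuting : commuting_derivations hder.
Proof.
split=> [i|i j f]; last exact: hshiftC.
by split=> // f g; exact: hshift_mul.
Qed.

Lemma apply_theta_hder t f u : apply_theta hder t f u = f (tadd u t).
Proof.
elim/Theta_ind: t f u => [|t i IH] f u; first by rewrite apply_theta0 tadd0.
by rewrite apply_thetaSr ?IH ?tshift_addr //; case: hder_commuting.
Qed.

Definition hev (f : H) : A := f (tzero m).

Lemma hev_zmod : zmod_morphism hev. Proof. by []. Qed.
Lemma hev_monoid : monoid_morphism hev.
Proof.
split; first by rewrite /hev /= /GRing.one /= /hone eqxx.
by move=> f g; rewrite /hev -[tzero m]/(wt [::]) hprodE.
Qed.
HB.instance Definition _ := GRing.isZmodMorphism.Build H A hev hev_zmod.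
HB.instance Definition _ := GRing.isMonoidMorphism.Build H A hev hev_monoid.

(** The filtration of H by order of vanishing at the origin, along which coordinates are computed
    degree by degree. *)
Definition vanish_below (N : nat) f := forall t, (tdeg t < N)%N -> f t = 0.

Lemma hmul_below N f g : vanish_below N f -> vanish_below N (f * g).
Proof.
move=> f0 t tN; rewrite -(wordK t) hprodE; apply: hmulw_zero => u v E; left; apply: f0.
apply: leq_ltn_trans tN; rewrite -{1}(wordK t) -E /tdeg; apply: leq_sum => i _.
by rewrite ffunE leq_addr.
Qed.

(** Every letter must fall on [f]: a term in which some letter falls on [g] takes a coefficient of
    [f] of degree below N. *)
Lemma hmul_lowest N f g t : vanish_below N f -> tdeg t = N -> (f * g) t = f t * g (tzero m).
Proof.
rewrite -(wordK t) tdeg_wt hprodE; elim: (word t) N f => [|i w IH] N f //= f0 N1.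
have f0' : vanish_below (size w) (hshift i f).
  by move=> u usz; apply: f0; rewrite tdeg_shift -N1.
rewrite (IH _ _ f0' erefl) -hprodE (hmul_below _ f0) ?addr0 //.
by rewrite tdeg_wt -N1.
Qed.

End HurwitzRing.

Section HurwitzJet.
Variables (m : nat) (A : comNzRingType) (d : 'I_m -> A -> A).

Definition hjet (dcom : commuting_derivations d) (c : A) : hurw m A :=
  fun t => apply_theta d t c.

Hypothesis dcom : commuting_derivations d.

Lemma hjet_der i c : hjet dcom (d i c) = hder i (hjet dcom c).
Proof.
apply/funext => t; rewrite /hjet /hder /hshift.
by rewrite apply_thetaSr //; case: dcom.
Qed.

Lemma hjet_zmod : zmod_morphism (hjet dcom).
Proof.
have [dder dC] := dcom.
move=> x y; apply/funext => t; rewrite hsubE /hjet.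
elim/Theta_ind: t => [|t i IH]; first by rewrite !apply_theta0.
by rewrite !apply_thetaS // IH (derB (dder i)).
Qed.

(** The recursion of [hmulw] along a word is the iterated product rule of the derivations of A. *)
Lemma hjet_monoid : monoid_morphism (hjet dcom).
Proof.
have [dder dC] := dcom; split.
  apply/funext => t; rewrite /hjet.
  case: (Theta_case t) => [->|[u [i ->]]].
    by rewrite apply_theta0 // /GRing.one /= /hone eqxx.
  rewrite apply_thetaSr // (der1 (dder i)).
  rewrite [RHS](_ : _ = (tshift u i == tzero m)%:R) // (negPf (tshift_neq0 u i)).
  elim/Theta_ind: u => [|u k IH]; first by rewrite apply_theta0.
  by rewrite apply_thetaS // IH (der0 (dder k)).
move=> x y; apply/funext => t; rewrite -(wordK t) hprodE.
elim: (word t) x y => [|i w IH] x y /=; first by rewrite /hjet !apply_theta0.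
rewrite -!/(hder _ _) -!hjet_der -!IH [LHS](_ : _ = hder i (hjet dcom (x * y)) (wt w)) //.
rewrite -hjet_der (derM (dder i)) /hjet.
have := hjet_zmod; move=> Z.
have ZD a b : hjet dcom (a + b) = hjet dcom a + hjet dcom b.
  have := Z (a + b) b; rewrite addrK => ->; by rewrite subrK.
by have := congr1 (fun h : hurw m A => h (wt w)) (ZD (d i x * y) (x * d i y)).
Qed.

HB.instance Definition _ := GRing.isZmodMorphism.Build A (hurw m A) (hjet dcom) hjet_zmod.
HB.instance Definition _ := GRing.isMonoidMorphism.Build A (hurw m A) (hjet dcom) hjet_monoid.

End HurwitzJet.

Section HurwitzMap.
Variables (m : nat) (A B : comNzRingType) (phi : {rmorphism A -> B}).

Definition hmap (f : hurw m A) : hurw m B := fun t => phi (f t).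

Lemma hmap_zmod : zmod_morphism hmap.
Proof. by move=> f g; apply/funext => t; rewrite /hmap hsubE rmorphB. Qed.

Lemma hmap_monoid : monoid_morphism hmap.
Proof.
split; first by apply/funext => t; rewrite /hmap /GRing.one /= /hone rmorph_nat.
move=> f g; apply/funext => t; rewrite /hmap -(wordK t) !hprodE.
elim: (word t) f g => [|i w IH] f g /=; first by rewrite rmorphM.
by rewrite rmorphD !IH.
Qed.

HB.instance Definition _ := GRing.isZmodMorphism.Build (hurw m A) (hurw m B) hmap hmap_zmod.
HB.instance Definition _ := GRing.isMonoidMorphism.Build (hurw m A) (hurw m B) hmap hmap_monoid.

Lemma hmap_der i f : hmap (hder i f) = hder i (hmap f).
Proof. by []. Qed.

End HurwitzMap.

Lemma tadd_eq0 m (t u : Theta m) : tadd t u = tzero m -> t = tzero m /\ u = tzero m.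
Proof.
move=> /ffunP E; split; apply/ffunP => j; have := E j; rewrite !ffunE => /eqP;
by rewrite addn_eq0 => /andP[/eqP ? /eqP ?].
Qed.

(** * Hurwitz series over a field of characteristic zero form a domain *)

Section HurwitzDomain.
Variables (m : nat) (L : fieldType).
Hypothesis char0 : [pchar L] =i pred0.

(* The constant C is a product of binomial coefficients. *)
Lemma hmulw_lead (f g : Theta m -> L) (w : seq 'I_m) (al be : Theta m) :
  tadd al be = wt w ->
  (forall t u, tadd t u = wt w -> (t, u) <> (al, be) -> f t = 0 \/ g u = 0) ->
  exists2 C, (0 < C)%N & hmulw f g w = f al * g be *+ C.
Proof.
elim: w f g al be => [|i w IH] f g al be /= E H.
  by have [-> ->] := tadd_eq0 E; exists 1%N.
have Hf (t u : Theta m) : tadd t u = wt w -> (tshift t i, u) <> (al, be) ->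
    hshift i f t = 0 \/ g u = 0.
  by move=> Etu; apply: H; rewrite tshift_addl Etu.
have Hg (t u : Theta m) : tadd t u = wt w -> (t, tshift u i) <> (al, be) ->
    f t = 0 \/ hshift i g u = 0.
  by move=> Etu; apply: H; rewrite tshift_addr Etu.
(* If [al i] is 0, all terms in which [i] falls on [f] vanish and the constant is 0. This cannot
   happen on both sides, because [i] occurs in the sum of [al] and [be]. *)
have [C1 C1al EC1] : exists2 C, (0 < al i -> 0 < C)%N &
    hmulw (hshift i f) g w = f al * g be *+ C.
  case: (posnP (al i)) => ali.
    exists 0%N; rewrite ?ali // hmulw_zero // => t u Etu; apply: Hf => // -[Eal _].
    by move: ali; rewrite -Eal ffunE eqxx addn1.
  have [al0 Eal] := tshift_pred ali.
  have [||C C0 ->] := IH (hshift i f) g al0 be; last by rewrite /hshift -Eal; exists C.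
    by apply: (@tshift_inj _ i); rewrite /= -tshift_addl -Eal E.
  by move=> t u Etu ne; apply: Hf => // -[Et Eu]; apply: ne; move: Et; rewrite Eal => /tshift_inj->; rewrite Eu.
have [C2 C2be EC2] : exists2 C, (0 < be i -> 0 < C)%N &
    hmulw f (hshift i g) w = f al * g be *+ C.
  case: (posnP (be i)) => bei.
    exists 0%N; rewrite ?bei // hmulw_zero // => t u Etu; apply: Hg => // -[_ Ebe].
    by move: bei; rewrite -Ebe ffunE eqxx addn1.
  have [be0 Ebe] := tshift_pred bei.
  have [||C C0 ->] := IH f (hshift i g) al be0; last by rewrite /hshift -Ebe; exists C.
    by apply: (@tshift_inj _ i); rewrite /= -tshift_addr -Ebe E.
  by move=> t u Etu ne; apply: Hg => // -[Et Eu]; apply: ne; move: Eu; rewrite Ebe => /tshift_inj->; rewrite Et.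
exists (C1 + C2)%N; last by rewrite EC1 EC2 mulrnDr.
move/ffunP/(_ i): E; rewrite !ffunE eqxx addn1 addn_gt0 => E.
case: (posnP (al i)) E => [->|/C1al->] //; rewrite add0n => E.
by rewrite C2be ?orbT // E.
Qed.

Lemma hurw_lowest (f : hurw m L) : f <> 0 ->
  exists2 t, f t <> 0 & forall u, rank_lt u t -> f u = 0.
Proof.
move=> f0; have [t ft] : exists t, f t <> 0.
  by apply/existsNP => H; apply: f0; apply/funext.
elim/(well_founded_ind (@rank_lt_wf m)): t ft => t IH ft.
case: (pselect (exists2 u, rank_lt u t & f u <> 0)) => [[u ut fu]|H]; first exact: (IH u ut fu).
by exists t => // u ut; apply: contrapT => fu; apply: H; exists u.
Qed.

(** Take [al] and [be] of lowest rank with nonzero coefficients. The ranking is compatible with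
    addition, so only this pair contributes to the coefficient at their sum, with a positive integer
    factor that is nonzero in characteristic zero. *)
Lemma hurw_domain (f g : hurw m L) : f * g = 0 -> f = 0 \/ g = 0.
Proof.
move=> fg0; apply: contrapT => /not_orP[f0 g0].
have [al fal lowf] := hurw_lowest f0; have [be gbe lowg] := hurw_lowest g0.
have [||C C0 EC] := hmulw_lead (f := f) (g := g) (w := word (tadd al be)) (al := al) (be := be).
- by rewrite wordK.
- move=> t u; rewrite wordK => E ne.
  case: (boolP (rank_lt t al)) => [/lowf|tal]; first by left.
  case: (boolP (rank_lt u be)) => [/lowg|ube]; first by right.
  case: ne; case: (eqVneq t al) => [et|net].
    by rewrite et; congr (_, _); apply: (@taddI _ _ _ al); rewrite taddC -{1}et E taddC.
  have lt1 : rank_lt al t by move: (rank_lt_total net); rewrite (negPf tal).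
  have : rank_lt (tadd al be) (tadd t be) by rewrite rank_lt_add2r.
  rewrite -E; case: (eqVneq u be) => [->|neu]; first by rewrite rank_lt_irr.
  move=> lt2; have lt3 : rank_lt be u by move: (rank_lt_total neu); rewrite (negPf ube).
  have : rank_lt (tadd t be) (tadd t u) by rewrite !(taddC t) rank_lt_add2r.
  by move/(rank_lt_trans lt2); rewrite rank_lt_irr.
have /eqP := congr1 (fun h : hurw m L => h (wt (word (tadd al be)))) fg0.
rewrite hprodE EC hzeroE -mulr_natr !mulf_eq0.
move/pcharf0P: char0 => ->.
by rewrite -[C == 0%N]negbK -lt0n C0 orbF => /orP[/eqP|/eqP].
Qed.

End HurwitzDomain.

(** * Lifting a basis to Hurwitz series *)

Section HurwitzBasis.
Variables (m : nat) (L : fieldType) (R : comAlgType L) (n : nat).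
Variables (e : 'I_n -> R) (c : R -> 'I_n -> L) (E : 'I_n -> hurw m R).
Hypothesis basis : forall r, r = \sum_i c r i *: e i.
Hypothesis free : forall a : 'I_n -> L, \sum_i a i *: e i = 0 -> forall i, a i = 0.
Hypothesis E0 : forall i, hev (E i) = e i.

Local Notation S b := (\sum_i hmap (in_alg R) (b i) * E i) (only parsing).

(** In the lowest degree only the constant coefficients [e i] of the series [E i] matter; freeness
    and spanning over H(L) thus reduce, degree by degree, to those of [e] over L. *)
Lemma hsum_lowest N (b : 'I_n -> hurw m L) t :
  (forall i, vanish_below N (b i)) -> tdeg t = N -> (S b : hurw m R) t = \sum_i b i t *: e i.
Proof.
move=> b0 tN; rewrite hsumE; apply: eq_bigr => i _.
rewrite (@hmul_lowest _ _ N) //; last by move=> u uN; rewrite /hmap b0 // rmorph0.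
have -> : E i (tzero m) = e i by exact: E0.
by rewrite /hmap /= -scalerAl mul1r.
Qed.

Lemma hsum_below N (b : 'I_n -> hurw m L) :
  (forall i, vanish_below N (b i)) -> vanish_below N (S b : hurw m R).
Proof.
move=> b0 t tN; rewrite hsumE big1 // => i _; apply: (@hmul_below _ _ N) => //.
by move=> u uN; rewrite /hmap b0 // rmorph0.
Qed.

Lemma hurw_free (b : 'I_n -> hurw m L) : S b = 0 -> forall i, b i = 0.
Proof.
move=> Sb; suff H N : forall i t, (tdeg t < N)%N -> b i t = 0.
  by move=> i; apply/funext => t; apply: (H (tdeg t).+1).
elim: N => [|N IH] // i t; rewrite ltnS leq_eqVlt => /orP[/eqP tN|]; last exact: IH.
apply: (free (a := fun i => b i t)); rewrite -(hsum_lowest (N := N)) ?Sb //.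
Qed.

Lemma hurw_span (y : hurw m R) : exists b : 'I_n -> hurw m L, y = S b.
Proof.
(* [B N] holds the coordinates in total degree below N. The next stage adds, in degree N, the
   coordinates of the error there, which leaves the sum unchanged in lower degrees. *)
pose fix B N : 'I_n -> hurw m L := if N is N'.+1 then
  fun i t => if tdeg t == N' then c ((y - S (B N')) t) i else B N' i t else fun _ => 0.
have B0 N i t : (N <= tdeg t)%N -> B N i t = 0.
  by elim: N => // N IH Nt /=; rewrite gtn_eqF // IH // ltnW.
have subS (b b' : 'I_n -> hurw m L) : S b - S b' = S (fun i => b i - b' i).
  by rewrite -sumrB; apply: eq_bigr => i _; rewrite rmorphB mulrBl.
have ByN N : vanish_below N (y - S (B N)).
  elim: N => // N IH t.
  pose C i : hurw m L := B N.+1 i - B N i.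
  have C0 i : vanish_below N (C i).
    by move=> u uN; rewrite /C hsubE /= ltn_eqF // subrr.
  have -> : y - S (B N.+1) = y - S (B N) - S C.
    by rewrite -subS opprB addrA subrK.
  rewrite ltnS leq_eqVlt hsubE => /orP[/eqP tN|tN]; last by rewrite IH // (hsum_below C0) ?subrr.
  rewrite (hsum_lowest C0 tN) {1}(basis ((y - S (B N)) t)) -sumrB big1 // => i _.
  by rewrite /C hsubE /= tN eqxx (B0 N) ?tN // subr0 subrr.
(* Coordinates of degree k are final from stage k+1 on. *)
pose b i : hurw m L := fun t => B (tdeg t).+1 i t.
exists b; apply/funext => t; apply/eqP; rewrite -subr_eq0 -hsubE; apply/eqP.
pose N := (tdeg t).+1.
have bN i : vanish_below N (b i - B N i).
  move=> u; rewrite hsubE /b; move: N => N; elim: N => // N IH.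
  rewrite ltnS leq_eqVlt => /orP[/eqP<-|uN]; first by rewrite subrr.
  by rewrite [B N.+1 i u]/= ltn_eqF // IH.
have -> : y - S b = y - S (B N) - S (fun i => b i - B N i).
  by rewrite -subS opprB addrA subrK.
by rewrite hsubE ByN // (hsum_below bN) ?subrr.
Qed.

End HurwitzBasis.

(** * Finite-dimensional local algebras *)

Section FiniteDim.
Variables (L : fieldType) (R : comAlgType L).

(** A spanning family of least length is free: a relation with nonzero coefficient at i would
    express [e i] through the others. *)
Lemma finite_dim_basis : finite_dim R ->
  exists (n : nat) (e : 'I_n -> R) (c : R -> 'I_n -> L),
    (forall r, r = \sum_i c r i *: e i) /\
    (forall a : 'I_n -> L, \sum_i a i *: e i = 0 -> forall i, a i = 0).
Proof.
move=> fd; pose spans n := `[< exists e : 'I_n -> R, forall r, exists c : 'I_n -> L,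
    r = \sum_(i < n) c i *: e i >].
have exs : exists n, spans n by case: fd => n [e He]; exists n; apply/asboolP; exists e.
case: (ex_minnP exs) => n /asboolP[e He] nmin.
exists n, e, (fun r => sval (cid (He r))); split=> [r|a a0 i]; first exact: svalP (cid (He r)).
apply: contrapT => /eqP ai.
case: n => [|n] in e He nmin a a0 i ai *; first by case: i {ai}.
suff /nmin : spans n by rewrite ltnn.
apply/asboolP; exists (fun j => e (lift i j)) => r.
have [c ->] := He r.
exists (fun j => c (lift i j) - c i / a i * a (lift i j)).
rewrite (bigD1_ord i) //=; rewrite (bigD1_ord i) //= in a0.
have -> : e i = - \sum_(j < n) ((a i)^-1 * a (lift i j)) *: e (lift i j).
  apply: (scalerI ai); rewrite scalerN scaler_sumr.
  under eq_bigr do rewrite scalerA mulrA divff // mul1r.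
  by apply/eqP; rewrite -addr_eq0 a0.
rewrite scalerN scaler_sumr addrC -sumrB; apply: eq_bigr => j _.
by rewrite scalerA mulrA scalerBl.
Qed.

(** The n+1 powers of r up to exponent n have coordinates in a space of dimension n; a row in the
    left kernel of their coordinate matrix is the coefficient vector of the polynomial. *)
Lemma algebraic_rel (r : R) : finite_dim R -> exists2 p : {poly L}, p != 0 & horner_alg r p = 0.
Proof.
move=> /finite_dim_basis[n [e [c [cE _]]]].
pose M : 'M[L]_(n.+1, n) := \matrix_(i, j) c (r ^+ i) j.
have : kermx M != 0.
  by rewrite -mxrank_eq0 mxrank_ker subn_eq0 -ltnNge ltnS rank_leq_col.
case/rowV0Pn => u /sub_kermxP uM u0.
exists (rVpoly u); first by apply: contra u0 => /eqP /(congr1 (fun q => poly_rV q : 'rV[L]_n.+1)); rewrite rVpolyK linear0 => ->.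
have -> : horner_alg r (rVpoly u) = \sum_(i < n.+1) u 0 i *: r ^+ i.
  rewrite /rVpoly poly_def rmorph_sum; apply: eq_bigr => i _.
  by rewrite -mul_polyC rmorphM rmorphXn /= horner_algC horner_algX valK mulr_algl.
under eq_bigr do rewrite [r ^+ _]cE scaler_sumr.
rewrite exchange_big big1 //= => j _.
under eq_bigr do rewrite scalerA.
rewrite -scaler_suml; have := congr1 (fun A : 'rV_n => A 0 j) uM; rewrite !mxE.
by under eq_bigr do rewrite mxE; move=> ->; rewrite scale0r.
Qed.

(* A proper ideal containing I and of maximal dimension over L is maximal. *)
Lemma exists_maximal_ideal (I : R -> Prop) : finite_dim R -> is_ideal I -> ~ I 1 ->
  exists2 J, is_maximal_ideal J & forall x, I x -> J x.
Proof.
move=> /finite_dim_basis[n [e [c [cE _]]]] Iid I1.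
pose phi (v : 'rV[L]_n) := \sum_i v 0 i *: e i.
have phiM k (u : 'rV_k) (A : 'M_(k, n)) : phi (u *m A) = \sum_i u 0 i *: phi (row i A).
  rewrite /phi; under [RHS]eq_bigr do rewrite scaler_sumr.
  rewrite exchange_big; apply: eq_bigr => j _ /=.
  by rewrite mxE scaler_suml; apply: eq_bigr => i _; rewrite scalerA mxE.
have phi_surj x : phi (\row_i c x i) = x.
  by rewrite {2}(cE x); apply: eq_bigr => i _; rewrite mxE.
have idZ (J : R -> Prop) (a : L) x : is_ideal J -> J x -> J (a *: x).
  by case=> _ [_ JM] Jx; rewrite -mulr_algl; apply: JM.
have idsub (J : R -> Prop) k (u : 'rV_k) (A : 'M_(k, n)) : is_ideal J ->
    (forall i, J (phi (row i A))) -> J (phi (u *m A)).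
  move=> Jid JA; have [J0 [JD _]] := Jid.
  by rewrite phiM; elim/big_ind: _ => // i _; apply: idZ.
(* The rows of [A] are only required to lie in J, so its rank bounds the dimension of J from below;
   at the maximal rank they span J. *)
pose ach k := `[< exists J (A : 'M[L]_n), [/\ is_ideal J, ~ J 1, forall x, I x -> J x,
    forall i, J (phi (row i A)) & \rank A = k] >].
have ach0 : exists k, ach k.
  exists 0%N; apply/asboolP; exists I, 0; split=> //; last exact: mxrank0.
  move=> i; rewrite row0 /phi big1; first by case: Iid.
  by move=> j _; rewrite mxE scale0r.
have achn k : ach k -> (k <= n)%N by case/asboolP => J [A [_ _ _ _ <-]]; exact: rank_leq_row.
case: (ex_maxnP ach0 achn) => k /asboolP[J [A [Jid J1 IJ JA Ak]]] kmax.
exists J => //; split=> //; split=> // J' J'id J'1 JJ' x J'x.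
apply: contrapT => Jx.
pose v : 'rV_n := \row_i c x i.
have vA : ~~ (v <= A)%MS.
  apply/negP => /submxP[u Eu]; apply: Jx.
  by rewrite -(phi_surj x) -/v Eu; apply: idsub.
suff /kmax : ach (\rank (A + v)%MS).
  rewrite -Ak leqNgt => /negP; apply; apply: rank_ltmx.
  by rewrite ltmxE addsmxSl /= addsmx_sub submx_refl.
apply/asboolP; exists J', (A + v)%MS; split=> //; first by move=> y /IJ/JJ'.
move=> i; have /sub_addsmxP[[u1 u2] /= ->] := row_sub i (A + v)%MS.
have -> : u1 *m A + u2 *m v = row_mx u1 u2 *m col_mx A v by rewrite mul_row_col.
apply: idsub => // l; rewrite -[l]splitK; case: (split l) => l' /=.
  by rewrite rowKu; apply: JJ'.
by rewrite rowKd (ord1 l') row_id phi_surj.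
Qed.

Variable mm : R -> Prop.
Hypotheses (fd : finite_dim R) (loc : local_with mm).

Lemma mm_ideal : is_ideal mm. Proof. by case: loc => -[]. Qed.
Lemma mm0 : mm 0. Proof. by case: mm_ideal. Qed.
Lemma mmD x y : mm x -> mm y -> mm (x + y). Proof. by case: mm_ideal => _ [+ _]; apply. Qed.
Lemma mmM r x : mm x -> mm (r * x). Proof. by case: mm_ideal => _ [_]; apply. Qed.
Lemma mm1 : ~ mm 1. Proof. by case: loc => -[_ []]. Qed.
Lemma mmN x : mm x -> mm (- x). Proof. by rewrite -mulN1r; exact: mmM. Qed.

(** The multiples of a non-unit form a proper ideal, which lies in a maximal ideal, and the only one
    is [mm]. *)
Lemma local_unit x : ~ mm x -> exists y, y * x = 1.
Proof.
move=> xmm; apply: contrapT => H; apply: xmm.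
pose I y := exists r, y = r * x.
have Iid : is_ideal I.
  split; first by exists 0; rewrite mul0r.
  split=> [y z [r ->] [s ->]|r y [s ->]]; first by exists (r + s); rewrite mulrDl.
  by exists (r * s); rewrite mulrA.
have I1 : ~ I 1 by case=> y Ey; apply: H; exists y.
have [J Jmax IJ] := exists_maximal_ideal fd Iid I1.
by apply/(loc.2 _ Jmax)/IJ; exists 1; rewrite mul1r.
Qed.

Lemma mm_prime x y : mm (x * y) -> mm x \/ mm y.
Proof.
move=> xy; case: (pselect (mm x)) => [|/local_unit[z zx]]; [by left|right].
by rewrite -[y]mul1r -zx -mulrA; apply: mmM.
Qed.

Lemma mm_alg (a : L) : mm a%:A -> a = 0.
Proof.
move=> ma; apply: contrapT => /eqP a0; apply: mm1.
by rewrite -[1](scale1r) -(mulVf a0) -scalerA -mulr_algl; apply: mmM.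
Qed.

(** Write an annihilating polynomial of x as q X^k with q(0) nonzero. Then q(x) is congruent to q(0)
    modulo [mm], hence a unit, and x^k = 0. *)
Lemma mm_nilpotent x : mm x -> exists N, x ^+ N = 0.
Proof.
move=> mx; have [p p0 px] := algebraic_rel x fd.
have [k [q /implyP/(_ p0) q0 Ep]] := multiplicity_XsubC p 0; exists k.
have E : horner_alg x q * x ^+ k = 0.
  by rewrite -px Ep rmorphM rmorphXn /= subr0 horner_algX.
suff /local_unit[y yq] : ~ mm (horner_alg x q) by rewrite -[_ ^+ k]mul1r -yq -mulrA E mulr0.
move=> mq; move/negP: q0; apply; rewrite rootE; apply/eqP/mm_alg.
have /factor_theorem[s Es] : root (q - (q.[0])%:P) 0 by rewrite rootE !hornerE subrr.
have -> : (q.[0])%:A = horner_alg x q - horner_alg x s * x.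
  have := congr1 (horner_alg x) Es; rewrite rmorphB rmorphM /= subr0 horner_algC horner_algX => <-.
  by rewrite opprB addrC subrK.
by apply: mmD => //; apply: mmN; apply: mmM.
Qed.

Section Residue.
Variables (m : nat) (dL : 'I_m -> L -> L) (dR : 'I_m -> R -> R).
Hypotheses (dLcom : commuting_derivations dL) (dRcom : commuting_derivations dR).
Hypothesis Lclosed : diff_closed dL.
Hypothesis dRL : forall i (c : L), dR i (c%:A) = (dL i c)%:A.
Hypothesis mmd : forall i x, mm x -> mm (dR i x).

(* The fraction field of R/mm is a differential extension of L in which r is algebraic:
   its minimal polynomial has a root in that field, hence in L, hence is linear. *)
Lemma residue_exists r : exists c : L, mm (r - c%:A).
Proof.
pose sz k := `[< exists p : {poly L}, [/\ p != 0, mm (horner_alg r p) & size p = k] >].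
have exsz : exists k, sz k.
  have [p p0 pr] := algebraic_rel r fd; exists (size p); apply/asboolP; exists p; split=> //.
  by rewrite pr; exact: mm0.
case: (ex_minnP exsz) => k /asboolP[p [p0 mp sp]] kmin.
have [K [dK [j [dKcom jd jP]]]] := prime_residue_field dRcom mm_ideal mm1 mm_prime mmd.
pose iota : {rmorphism L -> K} := j \o in_alg R.
have iotad i c : iota (dL i c) = dK i (iota c) by rewrite /= -jd dRL.
pose x0 : dvarC 1 m := (ord0, tzero m).
(* The polynomial [p] is read as a differential polynomial of order zero. *)
pose F : {malg L[cmonom (dvarC 1 m)]} := (map_poly (@mconst (dvarC 1 m) L) p).[mvar L x0].
have evF (S : comNzRingType) (phi : {rmorphism L -> S}) w :
    aeval phi w F = (map_poly phi p).[w x0].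
  rewrite -horner_map -map_poly_comp /= aevalX.
  by congr _.[_]; apply: eq_map_poly => y /=; rewrite aevalC.
have [|a [Fa _]] := Lclosed (iota := iota) dKcom iotad (eqs := [:: F]) (neqs := [::]).
  exists (fun _ => j r); split=> // f; rewrite inE => /eqP->.
  rewrite [LHS](dp_eval_map iota dK) evF /jet /= apply_theta0.
  move/jP: mp => <-; rewrite -[j (horner_alg _ _)]horner_map -map_poly_comp.
  by congr _.[_]; apply: eq_map_poly.
have := Fa F; rewrite inE eqxx => /(_ isT); rewrite [LHS](dp_evalE dL) evF.
rewrite map_poly_id // /jet /= apply_theta0 => /eqP/factor_theorem[q Eq].
exists (a ord0).
have q0 : q != 0 by apply: contra p0 => /eqP q0; rewrite Eq q0 mul0r.
(* As [mm] is prime, it contains q(r) or r - a; the first would contradict the minimal size of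
   [p]. *)
move: mp; rewrite Eq rmorphM rmorphB /= horner_algX horner_algC => /mm_prime[mq|//].
have /kmin : sz (size q) by apply/asboolP; exists q.
by rewrite -sp Eq size_Mmonic ?monicXsubC // size_XsubC addn2 ltnn.
Qed.

Lemma residueP r : mm (r - (residue mm r)%:A).
Proof. exact: (epsilon_spec _ _ (residue_exists r)). Qed.

Lemma residue_eq r c : mm (r - c%:A) -> residue mm r = c.
Proof.
move=> mc; apply/eqP; rewrite -subr_eq0; apply/eqP/mm_alg.
rewrite scalerBl; have -> : (residue mm r)%:A - c%:A = (r - c%:A) - (r - (residue mm r)%:A) :> R.
  by rewrite opprB [RHS]addrC addrA subrK.
by apply: mmD => //; apply/mmN/residueP.
Qed.

Lemma residue_morphism : exists rho : {rmorphism R -> L},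
  [/\ rho =1 residue mm, forall x, rho x = 0 <-> mm x, forall c, rho c%:A = c
    & forall i x, rho (dR i x) = dL i (rho x)].
Proof.
have zf : zmod_morphism (residue mm).
  move=> x y; apply: residue_eq; rewrite scalerBl.
  have -> (u v : R) : x - y - (u - v) = (x - u) - (y - v) by ring.
  by apply: mmD; [|apply: mmN]; exact: residueP.
have mf : monoid_morphism (residue mm).
  split=> [|x y]; apply: residue_eq; first by rewrite scale1r subrr; exact: mm0.
  have -> : (residue mm x * residue mm y)%:A = (residue mm x)%:A * (residue mm y)%:A :> R.
    by rewrite mulr_algl scalerA.
  have -> (u v : R) : x * y - u * v = x * (y - v) + v * (x - u) by ring.
  by apply: mmD; apply: mmM; exact: residueP.
pose rho : {rmorphism R -> L} := HB.pack (residue mm)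
  (GRing.isZmodMorphism.Build R L (residue mm) zf)
  (GRing.isMonoidMorphism.Build R L (residue mm) mf).
exists rho; split=> //= [x|c|i x].
- split=> [x0|mx]; last by apply: residue_eq; rewrite scale0r subr0.
  by have := residueP x; rewrite x0 scale0r subr0.
- by apply: residue_eq; rewrite subrr; exact: mm0.
- apply: residue_eq; rewrite -dRL -(derB (dRcom.1 i)); apply: mmd; exact: residueP.
Qed.

End Residue.
End FiniteDim.

(** * The algebraic point *)

Section Hensel.
Variables (R : comNzRingType) (p : {poly R}).

Lemma taylor2 (q : {poly R}) x h :
  exists s, q.[x + h] = q.[x] + q^`().[x] * h + h ^+ 2 * s.
Proof.
elim/poly_ind: q => [|q c [s E]]; first by exists 0; rewrite deriv0 !horner0; ring.
exists (s * (x + h) + q^`().[x]).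
rewrite derivD derivC derivM derivX !hornerE E; ring.
Qed.

Lemma unipotent_unit (z : R) N : z ^+ N = 0 -> exists y, y * (1 + z) = 1.
Proof.
move=> zN; exists (\sum_(i < N) (- z) ^+ i).
have := subrX1 (- z) N; rewrite exprNn zN mulr0 sub0r => E.
by rewrite mulrC -[RHS]opprK E -mulNr opprB opprK.
Qed.

(** Newton's iteration by induction on the nilpotency exponent: one step makes the value a multiple
    of its square. The correction is kept in the form p(x) r so that the root has the same residue
    as x. *)
Lemma hensel_nilpotent N x y : p.[x] ^+ N = 0 -> y * p^`().[x] = 1 ->
  exists r, p.[x + p.[x] * r] = 0.
Proof.
elim: N x y => [|N IH] x y.
  by rewrite expr0 => /eqP; rewrite oner_eq0.
(* Exponent 1 means that x is already a root; a Newton step lowers the exponent only from 2 on. *)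
case: N IH => [|N] IH pN yp; first by exists 0; rewrite mulr0 addr0 -[LHS]expr1.
set e := p.[x] in pN *.
have [q Eq] := taylor2 p x (e * - y).
have [s Es] := taylor2 p^`() x (e * - y).
have px1 : p.[x + e * - y] = e ^+ 2 * (y ^+ 2 * q).
  rewrite Eq -/e.
  have -> : p^`().[x] * (e * - y) = - e * (y * p^`().[x]) by ring.
  by rewrite yp; ring.
(* The derivative at the new point is p'(x) plus a multiple of the nilpotent [e], hence still a
   unit. *)
have [|y' y'E] := @unipotent_unit (y * (p^`()^`().[x] * (e * - y) + (e * - y) ^+ 2 * s)) N.+2.
  have -> : y * (p^`()^`().[x] * (e * - y) + (e * - y) ^+ 2 * s)
     = e * (y * (p^`()^`().[x] * - y + - y * (e * - y) * s)) by ring.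
  by rewrite exprMn pN mul0r.
have [||r Er] := IH (x + e * - y) (y' * y).
- have -> : p.[x + e * - y] ^+ N.+1 = e ^+ N.+2 * (e ^+ N * (y ^+ 2 * q) ^+ N.+1).
    by rewrite px1 exprMn -exprM mulrA -exprD; congr (_ ^+ _ * _); lia.
  by rewrite pN mul0r.
- by rewrite -mulrA Es -addrA mulrDr yp.
exists (- y + e * (y ^+ 2 * q) * r); rewrite -Er px1; congr _.[_]; ring.
Qed.

End Hensel.

Lemma rmorph_syzygy (B R : comNzRingType) (F : {rmorphism B -> R}) x y x' y' :
  F (x * y - x' * y') = F x * F y - F x' * F y'.
Proof. by rewrite rmorphB !rmorphM. Qed.

Lemma syzygy_cancel (R : comNzRingType) (x y x' y' z : R) :
  x * y - x' * y' = 0 -> y = 0 -> z * x' = 1 -> y' = 0.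
Proof.
move=> + y0 zx; rewrite y0 mulr0 sub0r => /eqP; rewrite oppr_eq0 => /eqP E.
by rewrite -[LHS]mul1r -zx -mulrA E mulr0.
Qed.

Lemma rmorph_mul_add (B R : comNzRingType) (F : {rmorphism B -> R}) x y z :
  F (x * y + z) = F x * F y + F z.
Proof. by rewrite rmorphD rmorphM. Qed.

(** * Derivations and saturated ideals *)

Section IdealDerivation.
Variables (B : comNzRingType) (D : B -> B).
Hypothesis Dder : is_derivation D.
Implicit Types (S : B -> Prop) (x y h : B).

Lemma in_ideal0 S : in_ideal S 0.
Proof. by exists 0%N, (fun _ => 0), (fun _ => 0); split=> [[]|]; rewrite ?big_ord0. Qed.

Lemma in_ideal_gen S g : S g -> in_ideal S g.
Proof. by exists 1%N, (fun _ => 1), (fun _ => g); rewrite big_ord1 mul1r. Qed.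

Lemma in_idealD S x y : in_ideal S x -> in_ideal S y -> in_ideal S (x + y).
Proof.
case=> k [c [g [Sg ->]]] [k' [c' [g' [Sg' ->]]]].
exists (k + k')%N, (fun j => match split j with inl i => c i | inr i => c' i end),
  (fun j => match split j with inl i => g i | inr i => g' i end).
split=> [j|]; first by case: (split j).
rewrite big_split_ord; congr (_ + _); apply: eq_bigr => j _.
  by rewrite (unsplitK (inl j)).
by rewrite (unsplitK (inr j)).
Qed.

Lemma in_idealM S r x : in_ideal S x -> in_ideal S (r * x).
Proof.
case=> k [c [g [Sg ->]]]; exists k, (fun j => r * c j), g; split=> //.
by rewrite mulr_sumr; apply: eq_bigr => j _; rewrite mulrA.
Qed.

Lemma in_ideal_ind S (T : B -> Prop) : T 0 -> (forall x y, T x -> T y -> T (x + y)) ->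
  (forall c g, S g -> T (c * g)) -> forall x, in_ideal S x -> T x.
Proof.
move=> T0 TD Tg x [k [c [g [Sg ->]]]].
by elim/big_ind: _ => // j _; apply: Tg.
Qed.

(** Membership in the saturation of the ideal of S by the powers of [h], the form in which coherence
    states its relations. *)
Definition saturated S h x := exists N, in_ideal S (h ^+ N * x).

Lemma saturated_gen S h x : in_ideal S x -> saturated S h x.
Proof. by exists 0%N; rewrite expr0 mul1r. Qed.

Lemma saturatedD S h x y : saturated S h x -> saturated S h y -> saturated S h (x + y).
Proof.
move=> [N xN] [N' yN]; exists (N + N')%N; rewrite mulrDr; apply: in_idealD.
  by rewrite exprD mulrAC mulrC; apply: in_idealM.
by rewrite exprD -mulrA; apply: in_idealM.
Qed.

Lemma in_ideal_der S S' x : (forall g, S g -> S' g /\ S' (D g)) ->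
  in_ideal S x -> in_ideal S' x /\ in_ideal S' (D x).
Proof.
move=> SS'; apply: (in_ideal_ind (T := fun y => in_ideal S' y /\ in_ideal S' (D y))).
- by rewrite (der0 Dder); split; apply: in_ideal0.
- by move=> y z [y1 y2] [z1 z2]; rewrite (derD Dder); split; apply: in_idealD.
- move=> c g /SS'[Sg SDg]; rewrite (derM Dder); split; first exact/in_idealM/in_ideal_gen.
  by apply: in_idealD; apply/in_idealM/in_ideal_gen.
Qed.

(** One more power of h absorbs the derivative of h^N: h^(N+1) D x = h D(h^N x) - N (D h) h^N x. *)
Lemma saturated_der S S' h x : (forall g, S g -> S' g /\ S' (D g)) ->
  saturated S h x -> saturated S' h (D x).
Proof.
move=> SS' [N /(in_ideal_der SS')[xN DxN]]; exists N.+1.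
have -> : h ^+ N.+1 * D x = h * D (h ^+ N * x) + (- (D h *+ N)) * (h ^+ N * x).
  rewrite (derM Dder); case: N {xN DxN} => [|N]; first by rewrite !expr0 (der1 Dder) expr1; ring.
  by rewrite (derX Dder) !exprS; ring.
by apply: in_idealD; apply: in_idealM.
Qed.

(* By the Leibniz rule, the other terms of D (s x - s' x') are multiples of x and x'. *)
Lemma saturated_syzygy S S' h s x s' x' : (forall g, S g -> S' g /\ S' (D g)) ->
  S' x -> S' x' -> saturated S h (s * x - s' * x') -> saturated S' h (s * D x - s' * D x').
Proof.
move=> SS' S'x S'x' /(saturated_der SS') H.
have -> : s * D x - s' * D x' = D (s * x - s' * x') + ((- D s) * x + D s' * x').
  by rewrite (derB Dder) !(derM Dder); ring.
apply: saturatedD => //; apply: saturated_gen.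
by apply: in_idealD; apply/in_idealM/in_ideal_gen.
Qed.

Lemma saturated_kernel (R : comNzRingType) (F : {rmorphism B -> R}) S h x u :
  (forall g, S g -> F g = 0) -> u * F h = 1 -> saturated S h x -> F x = 0.
Proof.
move=> FS uh [N].
have FI y : in_ideal S y -> F y = 0.
  apply: (in_ideal_ind (T := fun z => F z = 0)); first exact: rmorph0.
  - by move=> y' z Fy Fz; rewrite rmorphD Fy Fz addr0.
  - by move=> c g /FS Fg; rewrite rmorphM Fg mulr0.
move=> /FI; rewrite rmorphM rmorphXn => E.
by rewrite -[F x]mul1r -(expr1n _ N) -uh exprMn -mulrA E mulr0.
Qed.

End IdealDerivation.

Section Syzygies.
Variables (R : comNzRingType) (m : nat) (dR : 'I_m -> R -> R).
Hypothesis dRcom : commuting_derivations dR.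
Local Notation DPR := {malg R[cmonom (dvarC 1 m)]}.
Variable Lam : seq DPR.
Implicit Types (f g h : DPR) (t u v : Theta m).

(* Lam_gens with the leader of theta f replaced by theta (leader f). *)
Definition theta_gens v h :=
  exists f t, [/\ f \in Lam, h = dp_theta dR t f & rank_lt (tadd t (leader f)) v].

Lemma theta_gens_der v i h : theta_gens v h ->
  theta_gens (tshift v i) h /\ theta_gens (tshift v i) (dp_deriv dR i h).
Proof.
case=> f [t [fLam -> lt]]; split; exists f; [exists t | exists (tshift t i)]; split=> //.
- exact: rank_lt_trans lt (rank_lt_tshift _ _).
- by rewrite dp_thetaS.
- by rewrite tshift_addl rank_lt_tshift2.
Qed.

Hypothesis coh : coherent dR Lam.
Hypothesis Lam_gensP : forall v h, Lam_gens dR Lam v h -> theta_gens v h.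

(** Extends the relation of coherence from the least common derivative of two leaders to all those
    above it: each further derivation turns the relation at t into the one at [tshift t i], with
    generators one step higher in rank. *)
Lemma coherent_syzygy f g tf tg t : f \in Lam -> g \in Lam -> f != g ->
  tadd tf (leader f) = tadd tg (leader g) ->
  (forall tf' tg', tadd tf' (leader f) = tadd tg' (leader g) ->
     ~~ rank_lt (tadd tf' (leader f)) (tadd tf (leader f))) ->
  saturated (theta_gens (tadd t (tadd tf (leader f)))) (H_Lambda Lam)
    (separant g * dp_theta dR (tadd t tf) f - separant f * dp_theta dR (tadd t tg) g).
Proof.
move=> fL gL fg E least; elim/Theta_ind: t => [|t i IH].
  rewrite !t0add; have [N [k [c [e [Se Ee]]]]] := coh.2 f g fL gL fg tf tg E least.
  by exists N, k, c, e; split=> // j; apply: Lam_gensP.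
rewrite !tshift_addl.
rewrite -> (dp_thetaS dRcom (tadd t tf) i f), (dp_thetaS dRcom (tadd t tg) i g).
have Dd : is_derivation (dp_deriv dR i : DPR -> DPR) by exact: dp_deriv_derivation.
apply: (saturated_syzygy Dd _ _ _ IH) => [h||]; first exact: theta_gens_der.
  exists f, (tadd t tf); split=> //.
  by rewrite -taddA rank_lt_tshift.
exists g, (tadd t tg); split=> //.
by rewrite -taddA -E rank_lt_tshift.
Qed.

End Syzygies.

(** * Construction of the family Y *)

Section AlgebraicPoint.
Variables (L : fieldType) (R : comNzRingType) (rho : {rmorphism R -> L}) (s : L -> R).
Variables (m : nat) (dL : 'I_m -> L -> L) (dR : 'I_m -> R -> R).
Local Notation DPR := {malg R[cmonom (dvarC 1 m)]}.
Variables (Lam : seq DPR) (a : L).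
Implicit Types (f g h : DPR) (t u v : Theta m) (Z : Theta m -> R).

Hypothesis rho_s : cancel s rho.
Hypothesis rho_unit : forall x, rho x <> 0 -> exists y, y * x = 1.
Hypothesis rho_nil : forall x, rho x = 0 -> exists N, x ^+ N = 0.
Hypotheses (dLcom : commuting_derivations dL) (dRcom : commuting_derivations dR).
Hypothesis rho_d : forall i x, rho (dR i x) = dL i (rho x).

Definition ev Z f : R := aeval idfun (fun v : dvarC 1 m => Z v.2) f.
Definition evL f : L := aeval rho (jet dL (fun _ : 'I_1 => a)) f.
Definition lifts Z := forall t, rho (Z t) = apply_theta dL t a.

Lemma ev_eq (P : Theta m -> Prop) Z Z' f :
  tvars P f -> (forall t, P t -> Z t = Z' t) -> ev Z f = ev Z' f.
Proof. by move=> Pf E; apply: aeval_eq_in Pf _ => v; apply: E. Qed.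

Lemma ev_mul_add Z f g h : ev Z (f * g + h) = ev Z f * ev Z g + ev Z h.
Proof. exact: (rmorph_mul_add (aeval idfun (fun v : dvarC 1 m => Z v.2))). Qed.

Lemma ev_tvar Z t : ev Z (tvar R t) = Z t.
Proof. exact: aevalX. Qed.

Lemma rho_ev Z f : lifts Z -> rho (ev Z f) = evL f.
Proof.
move=> lZ; rewrite /ev aeval_comp; apply: aeval_ext => // v /=.
by rewrite lZ.
Qed.

Lemma evL_theta t f : evL f = 0 -> evL (dp_theta dR t f) = 0.
Proof.
move=> f0; rewrite /evL (aeval_theta dRcom _ _ dLcom) //; last first.
  by move=> i v; apply: jetS.
rewrite -/(evL f) f0; elim/Theta_ind: t => [|t i IH]; first by rewrite apply_theta0.
by rewrite apply_thetaS ?IH ?(der0 (dLcom.1 i)) //; case: dLcom.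
Qed.

Lemma upd_eq Z v c : upd Z v c v = c.
Proof. by rewrite /upd eqxx. Qed.

Lemma upd_lt Z v c t : rank_lt t v -> upd Z v c t = Z t.
Proof.
by rewrite /upd; case: eqP => // ->; rewrite rank_lt_irr.
Qed.

Lemma lifts_upd Z v c : lifts Z -> rho c = apply_theta dL v a -> lifts (upd Z v c).
Proof. by move=> lZ rc t; rewrite /upd; case: eqP => [->|]. Qed.

Lemma lifts_s : lifts (fun t => s (apply_theta dL t a)).
Proof. by move=> t; rewrite rho_s. Qed.

Hypothesis Lam_leader : forall f, f \in Lam -> ~~ dp_const f.
Hypothesis coh : coherent dR Lam.
Hypothesis Lam0 : forall f, f \in Lam -> evL f = 0.
Hypothesis sep0 : forall f, f \in Lam -> evL (separant f) <> 0.
Hypothesis H0 : evL (H_Lambda Lam) <> 0.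

(** A proper theta f is linear in [tadd t (leader f)] with the separant as coefficient, which is
    nonzero because its value at [a] is. This identifies the leader of theta f, so the generators
    allowed by coherence are those of [theta_gens]. *)
Lemma appears_leader f t : f \in Lam -> appears (tadd t (leader f)) (dp_theta dR t f).
Proof.
move=> fL; case: (eqVneq t (tzero m)) => [->|t0].
  by rewrite t0add dp_theta0; apply/leader_appears/Lam_leader.
set u := tadd t (leader f); apply: contrapT => /negP nu.
have [g [E gu]] := dp_theta_split dRcom f t0; rewrite -/u in E gu.
pose Z t := s (apply_theta dL t a).
have lu : rank_lt (leader f) u by apply: rank_lt_addl.
have sepu : tvars (fun w => rank_lt w u) (separant f).
  apply: (vars_in_sub (P := fun w : dvarC 1 m => rank_le w.2 (leader f))) => [w|]; last exact: tvars_separant.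
  by case=> [->//|/rank_lt_trans]; apply.
have Zu c : ev (upd Z u c) (dp_theta dR t f) = ev Z (separant f) * c + ev Z g.
  rewrite E ev_mul_add ev_tvar upd_eq.
  by congr (_ * _ + _); [apply: (ev_eq sepu)|apply: (ev_eq gu)] => w; exact: upd_lt.
(* If [u] did not occur, the values 0 and 1 at [u] would give the same result, whereas they differ
   by the value of the separant. *)
have : ev (upd Z u 0) (dp_theta dR t f) = ev (upd Z u 1) (dp_theta dR t f).
  apply: (ev_eq (P := fun w => w != u)) => [|w wu]; last by rewrite /upd (negPf wu).
  by apply/tvarsP => w wa; apply: contra nu => /eqP <-.
rewrite !Zu mulr0 mulr1 => /addIr sep; case: (sep0 fL).
by rewrite -(rho_ev _ lifts_s) -sep rmorph0.
Qed.

Lemma Lam_gens_theta v h : Lam_gens dR Lam v h -> theta_gens dR Lam v h.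
Proof.
case=> f [t [fL [-> lt]]]; exists f, t; split=> //.
have nlt := leader_max (appears_leader t fL).
case: (eqVneq (tadd t (leader f)) (leader (dp_theta dR t f))) => [->//|ne].
by move: (rank_lt_total ne); rewrite (negPf nlt) orbF => /rank_lt_trans; apply.
Qed.

(* The value at v is forced by one f with a derivative of leader v; the syzygy of f and g
   then shows that it suits every other g. *)
Lemma extend_point v Z : lifts Z ->
  (forall f t, f \in Lam -> rank_lt (tadd t (leader f)) v -> ev Z (dp_theta dR t f) = 0) ->
  exists c, rho c = apply_theta dL v a /\
    forall f t, f \in Lam -> tadd t (leader f) = v -> ev (upd Z v c) (dp_theta dR t f) = 0.
Proof.
move=> lZ Z0.
case: (pselect (exists f t, f \in Lam /\ tadd t (leader f) = v)) => [|none]; last first.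
  exists (s (apply_theta dL v a)); split=> [|f t fL E]; first exact: rho_s.
  by case: none; exists f, t.
case=> f [t [fL Ev]].
suff [c [rc fc]] : exists c, rho c = apply_theta dL v a /\ ev (upd Z v c) (dp_theta dR t f) = 0.
  exists c; split=> // g t' gL Eg.
  case: (eqVneq f g) => [fg|fg].
    by rewrite -fg; have -> : t' = t by apply: (@taddI _ _ _ (leader f)); rewrite Ev fg.
  (* The least common derivative of the two leaders; [v] is a derivative of it. *)
  pose u : Theta m := [ffun j => maxn (leader f j) (leader g j)].
  have lt_u w t1 t2 : w = tadd t1 (leader f) -> w = tadd t2 (leader g) -> tle u w.
    move=> E1 E2; apply/forallP => j; rewrite ffunE geq_max.
    by apply/andP; split; [rewrite E1|rewrite E2]; rewrite ffunE leq_addl.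
  have [tf Ef] : exists tf, u = tadd tf (leader f).
    by apply/tle_addP/forallP => j; rewrite ffunE leq_maxl.
  have [tg Eg'] : exists tg, u = tadd tg (leader g).
    by apply/tle_addP/forallP => j; rewrite ffunE leq_maxr.
  have /tle_addP[tau Etau] := lt_u v t t' (esym Ev) (esym Eg).
  have Et : t = tadd tau tf by apply: (@taddI _ _ _ (leader f)); rewrite -taddA -Ef -Etau.
  have Et' : t' = tadd tau tg by apply: (@taddI _ _ _ (leader g)); rewrite -taddA -Eg' -Etau.
  have lZc : lifts (upd Z v c) by apply: lifts_upd.
  have [y yH] : exists y, y * ev (upd Z v c) (H_Lambda Lam) = 1.
    by apply: rho_unit; rewrite rho_ev.
  have [z zS] : exists z, z * ev (upd Z v c) (separant f) = 1.
    by apply: rho_unit; rewrite rho_ev //; apply: sep0.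
  have least tf' tg' : tadd tf' (leader f) = tadd tg' (leader g) ->
      ~~ rank_lt (tadd tf' (leader f)) (tadd tf (leader f)).
    by move=> E; rewrite -Ef; apply/tle_rank_ge/(lt_u _ tf' tg').
  have syz := coherent_syzygy dRcom coh Lam_gens_theta tau fL gL fg (etrans (esym Ef) Eg') least.
  rewrite -Ef -Etau -Et -Et' in syz.
  (* These generators involve only indeterminates ranked below [v], so the value chosen at [v] does
     not affect them. *)
  have kill h : theta_gens dR Lam v h -> ev (upd Z v c) h = 0.
    case=> f' [t1 [f'L -> lt]]; rewrite -[RHS](Z0 f' t1 f'L lt).
    apply: (ev_eq (tvars_theta dRcom (f := f') (t := t1))) => w wl; apply: upd_lt.
    by case: wl => [->|/rank_lt_trans] //; apply.
  have E : ev (upd Z v c) (separant g) * ev (upd Z v c) (dp_theta dR t f)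
      - ev (upd Z v c) (separant f) * ev (upd Z v c) (dp_theta dR t' g) = 0.
    pose F : {rmorphism DPR -> R} := aeval idfun (fun w : dvarC 1 m => upd Z v c w.2).
    exact: etrans (esym (rmorph_syzygy F _ _ _ _)) (saturated_kernel (F := F) kill yH syz).
  exact: syzygy_cancel E fc zS.
(* If [v] is the leader itself, Hensel's lemma starts from an arbitrary lift of theta a; the
   correction is a multiple of a value with residue 0, so the residue is kept. Otherwise the
   equation is linear in the value at [v]. *)
case: (eqVneq t (tzero m)) => [t0|t0].
  have vE : leader f = v by rewrite -Ev t0 t0add.
  have [p pE] := aeval_upd_poly (fun w : dvarC 1 m => Z w.2) (xv v : dvarC 1 m) f.
  have updE c h : aeval idfun (upd (fun w : dvarC 1 m => Z w.2) (xv v : dvarC 1 m) c) h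
      = ev (upd Z v c) h.
    apply: aeval_ext => // -[k w]; rewrite /upd (ord1 k) /=.
    by rewrite -[_ == _]/((ord0, w) == xv v :> dvar 1 m) /xv xpair_eqE eqxx.
  pose c0 := s (apply_theta dL v a).
  have lc0 : lifts (upd Z v c0) by apply: lifts_upd => //; exact: rho_s.
  have [p0 p0'] := pE c0; rewrite !updE in p0 p0'.
  have [N pN] : exists N, p.[c0] ^+ N = 0 by apply: rho_nil; rewrite p0 rho_ev // Lam0.
  have [y yp] : exists y, y * p^`().[c0] = 1.
    by apply: rho_unit; rewrite p0' rho_ev // -vE -separantE; apply: sep0.
  have [r pr] := hensel_nilpotent pN yp.
  exists (c0 + p.[c0] * r); split.
    by rewrite rmorphD rmorphM p0 rho_ev // Lam0 // mul0r addr0 rho_s.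
  by rewrite t0 dp_theta0 -updE -(pE _).1.
have [g [E gv]] := dp_theta_split dRcom f t0; rewrite Ev in E gv.
have lv : rank_lt (leader f) v by rewrite -Ev; apply: rank_lt_addl.
have sepv : tvars (fun w => rank_lt w v) (separant f).
  apply: (vars_in_sub (P := fun w : dvarC 1 m => rank_le w.2 (leader f))) => [w|]; last exact: tvars_separant.
  by case=> [->//|/rank_lt_trans]; apply.
have Zv c : ev (upd Z v c) (dp_theta dR t f) = ev Z (separant f) * c + ev Z g.
  rewrite E ev_mul_add ev_tvar upd_eq.
  by congr (_ * _ + _); [apply: (ev_eq sepv)|apply: (ev_eq gv)] => w; exact: upd_lt.
have [y yS] : exists y, y * ev Z (separant f) = 1.
  by apply: rho_unit; rewrite rho_ev //; apply: sep0.
exists (- (y * ev Z g)); split; last first.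
  by rewrite Zv mulrN mulrCA mulrA yS mul1r addNr.
(* The residue of the solution is forced: at the lift [c0] the linear expression has as residue the
   value of theta f at [a], which is 0, and the residue of the separant can be divided out. *)
pose c0 := s (apply_theta dL v a).
have lc0 : lifts (upd Z v c0) by apply: lifts_upd => //; exact: rho_s.
have := rho_ev (dp_theta dR t f) lc0; rewrite Zv evL_theta ?Lam0 // rmorphD rmorphM rho_s.
move=> /eqP; rewrite addrC addr_eq0 => /eqP Eg.
rewrite rmorphN rmorphM Eg mulrN opprK mulrA -rmorphM yS rmorph1 mul1r; reflexivity.
Qed.

Lemma algebraic_point : exists Y : Theta m -> R, lifts Y /\
  forall f t, f \in Lam -> ev Y (dp_theta dR t f) = 0.
Proof.
pose good v Z c := rho c = apply_theta dL v a /\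
  forall f t, f \in Lam -> tadd t (leader f) = v -> ev (upd Z v c) (dp_theta dR t f) = 0.
pose choice v Z := if pselect (exists c, good v Z c) is left H then sval (cid H) else 0.
have choiceP v Z : (exists c, good v Z c) -> good v Z (choice v Z).
  by rewrite /choice; case: pselect => // H _; exact: svalP (cid H).
(* Values not yet constructed are filled with arbitrary lifts, so that the partial family satisfies
   [lifts]; the equations with leader [v] do not involve them. *)
pose ext v (rec : forall w, rank_lt w v -> R) w : R :=
  if pselect (rank_lt w v) is left h then rec w h else s (apply_theta dL w a).
pose Y := Fix (@rank_lt_wf m) (fun _ => R) (fun v rec => choice v (ext v rec)).
pose Z v w := if pselect (rank_lt w v) then Y w else s (apply_theta dL w a).
have YE v : Y v = choice v (Z v).
  rewrite /Y Fix_eq -/Y.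
    by congr choice; apply/funext => w; rewrite /ext /Z; case: pselect.
  move=> x f g fg; congr choice; apply/funext => w; rewrite /ext.
  by case: pselect.
have ZY v w : rank_lt w v -> Z v w = Y w by rewrite /Z; case: pselect.
have main v : rho (Y v) = apply_theta dL v a /\
    forall f t, f \in Lam -> tadd t (leader f) = v -> ev Y (dp_theta dR t f) = 0.
  elim/(well_founded_ind (@rank_lt_wf m)): v => v IH.
  have lZ : lifts (Z v).
    by move=> w; rewrite /Z; case: pselect => [wv|nwv]; [exact: (IH w wv).1 | exact: rho_s].
  have [rY Y0] : good v (Z v) (Y v).
    rewrite YE; apply/choiceP/extend_point => // f t fL lt; rewrite -[RHS]((IH _ lt).2 f t fL erefl).
    apply: (ev_eq (tvars_theta dRcom (f := f) (t := t))) => w wl; apply: ZY.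
    by case: wl => [->|/rank_lt_trans] //; apply.
  split=> // f t fL Ev; rewrite -[RHS](Y0 f t fL Ev).
  apply: (ev_eq (tvars_theta dRcom (f := f) (t := t))) => w; rewrite Ev => -[->|wv].
    by rewrite upd_eq.
  by rewrite upd_lt // ZY.
exists Y; split=> [t|f t fL]; first by case: (main t).
exact: (main _).2.
Qed.

End AlgebraicPoint.

(** * The differential point *)

Lemma rmorph_sum_mul_sub (B S : comNzRingType) (F : {rmorphism B -> S}) (J : finType)
    (x y : J -> B) z : F (\sum_j x j * y j - z) = \sum_j F (x j) * F (y j) - F z.
Proof. by rewrite rmorphB rmorph_sum; congr (_ - _); apply: eq_bigr => j _; rewrite rmorphM. Qed.

Lemma rmorph_sum_mul (B S : comNzRingType) (F : {rmorphism B -> S}) (J : finType)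
    (x y : J -> B) : F (\sum_j x j * y j) = \sum_j F (x j) * F (y j).
Proof. by rewrite rmorph_sum; apply: eq_bigr => j _; rewrite rmorphM. Qed.

Lemma rmorph_prod_neq0 (B : comNzRingType) (L : fieldType) (F : {rmorphism B -> L}) (J : eqType)
    (r : seq J) (x y : J -> B) j :
  F (\prod_(j <- r) (x j * y j)) != 0 -> j \in r -> F (y j) <> 0.
Proof.
move=> + jr; rewrite rmorph_prod prodf_seq_neq0 => /allP/(_ j jr) /=.
by rewrite rmorphM mulf_eq0 negb_or => /andP[_ /eqP].
Qed.

(** Decomposing each coefficient of Q over the basis commutes with evaluation at points coming from
    S'. Used both for H(L) -> H(R), to obtain the equations, and for L -> R, to return from their
    solution to R. *)
Lemma aeval_coord (I : choiceType) (L S' : comNzRingType) (R S : comNzRingType) n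
    (e : 'I_n -> R) (c : R -> 'I_n -> L) (alg : L -> R)
    (phi : {rmorphism R -> S}) (iota : {rmorphism L -> S'}) (sigma : {rmorphism S' -> S})
    (w : I -> S') (Q : {malg R[cmonom I]}) :
  (forall r, r = \sum_k alg (c r k) * e k) -> (forall l, sigma (iota l) = phi (alg l)) ->
  aeval phi (sigma \o w) Q =
  \sum_k sigma (aeval iota w (\sum_(mu <- msupp Q) << c Q@_mu k *g mu >>)) * phi (e k).
Proof.
move=> cE sE; have cmvalE mu : cmval (sigma \o w) mu = sigma (cmval w mu).
  by rewrite /cmval rmorph_prod; apply: eq_bigr => v _; rewrite rmorphXn.
have coordE k : sigma (aeval iota w (\sum_(mu <- msupp Q) << c Q@_mu k *g mu >>))
    = \sum_(mu <- msupp Q) phi (alg (c Q@_mu k)) * cmval (sigma \o w) mu.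
  rewrite !rmorph_sum; apply: eq_bigr => mu _ /=.
  by rewrite aevalU rmorphM sE cmvalE.
under [RHS]eq_bigr do rewrite coordE mulr_suml.
rewrite exchange_big aevalE; apply: eq_bigr => mu _ /=.
rewrite {1}[Q@_mu]cE rmorph_sum mulr_suml; apply: eq_bigr => k _.
by rewrite rmorphM mulrAC.
Qed.

Section GenericPoint.
Variables (R S : comNzRingType) (m n : nat) (dR : 'I_m -> R -> R) (dS : 'I_m -> S -> S).
Hypotheses (dRcom : commuting_derivations dR) (dScom : commuting_derivations dS).
Variables (phi : {rmorphism R -> S}) (e : 'I_n -> R).
Hypothesis phid : forall i r, phi (dR i r) = dS i (phi r).
Local Notation DPn := {malg R[cmonom (dvarC n m)]}.

Definition generic_point : DPn := \sum_i mconst (dvarC n m) (e i) * mvar R ((i, tzero m) : dvarC n m).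

(* f evaluated at the generic element of R, whose coordinates in the family e are the
   n differential indeterminates. *)
Definition generic_value (f : {malg R[cmonom (dvarC 1 m)]}) : DPn :=
  aeval (@mconst (dvarC n m) R)
    (jet (dp_deriv dR : 'I_m -> DPn -> DPn) (fun _ : 'I_1 => generic_point)) f.

(** Evaluation at the jets of [b] is a differential morphism, so it carries the jets of the generic
    point to those of its image. *)
Lemma aeval_generic (b : 'I_n -> S) f :
  aeval phi (jet dS b) (generic_value f)
  = aeval phi (jet dS (fun _ : 'I_1 => \sum_i phi (e i) * b i)) f.
Proof.
pose T : {rmorphism DPn -> S} := aeval phi (jet dS b).
have TD i Q : T (dp_deriv dR i Q) = dS i (T Q).
  apply: (aeval_mderiv (dRcom.1 i) _ (dScom.1 i)) => [r|v]; first exact: phid.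
  exact: jetS.
have TC r : T (mconst (dvarC n m) r) = phi r by exact: aevalC.
have TX i : T (mvar R ((i, tzero m) : dvarC n m)) = b i.
  apply: etrans (aevalX _ _ _) _; by rewrite /jet /= apply_theta0.
have TP : T generic_point = \sum_i phi (e i) * b i.
  apply: etrans (rmorph_sum_mul T _ _) _; apply: eq_bigr => i _.
  by congr (_ * _); [exact: TC | exact: TX].
apply: etrans (aeval_comp _ T _ f) _; apply: aeval_ext => [r|v]; first exact: TC.
rewrite -TP; exact: (apply_theta_morph TD).
Qed.

End GenericPoint.

Section Main.
Variables (L : fieldType) (m : nat) (dL : 'I_m -> L -> L).
Variables (R : comAlgType L) (dR : 'I_m -> R -> R).
Hypothesis char0 : [pchar L] =i pred0.
Hypotheses (dLcom : commuting_derivations dL) (dRcom : commuting_derivations dR).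
Hypothesis dRL : forall i (c : L), dR i (c%:A) = (dL i c)%:A.

Lemma hurw_diff_closed n (eqs : seq {malg L[cmonom (dvarC n m)]}) (b : 'I_n -> hurw m L) :
  diff_closed dL ->
  (forall F, F \in eqs -> aeval (hjet dLcom) (jet (@hder m L) b) F = 0) ->
  exists a : 'I_n -> L, forall F, F \in eqs -> aeval idfun (jet dL a) F = 0.
Proof.
move=> closed eqs0.
have [|||||K [dK [j [dKcom jd j0]]]] :=
    @prime_residue_field (hurw m L) m (@hder m L) (fun x => x = 0).
- exact: hder_commuting.
- by split=> //; split=> [x y -> ->|r x ->]; rewrite ?addr0 ?mulr0.
- by move/eqP; rewrite oner_eq0.
- exact: hurw_domain.
- by move=> i x ->; apply: der0; case: (hder_commuting m L).
pose iota : {rmorphism L -> K} := j \o hjet dLcom.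
have iotad i c : iota (dL i c) = dK i (iota c) by rewrite /= hjet_der jd.
have [|a [a0 _]] := closed K dK iota dKcom iotad n eqs [::].
  exists (fun i => j (b i)); split=> // F Feqs.
  apply: etrans (dp_eval_map iota dK (fun i => j (b i)) F) _.
  rewrite -[RHS](rmorph0 j) -(eqs0 F Feqs) aeval_comp.
  by apply: aeval_ext => // v /=; rewrite /jet (apply_theta_morph jd).
exists a => F /a0 E; exact: etrans (esym (dp_evalE dL a F)) E.
Qed.

Variables (rho : {rmorphism R -> L}) (a : L).
Hypothesis rho_alg : forall c : L, rho c%:A = c.
Hypothesis rho_d : forall i x, rho (dR i x) = dL i (rho x).

Lemma rational_point (Lam : seq {malg R[cmonom (dvarC 1 m)]}) (Y : Theta m -> R) :
  diff_closed dL -> finite_dim R ->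
  (forall t, rho (Y t) = apply_theta dL t a) ->
  (forall f t, f \in Lam -> ev Y (dp_theta dR t f) = 0) ->
  exists b : R, rho b = a /\ forall f, f \in Lam -> aeval idfun (jet dR (fun _ : 'I_1 => b)) f = 0.
Proof.
move=> closed /finite_dim_basis[n [e [c [cE efree]]]] Ylift Y0.
have cE' r : r = \sum_k in_alg R (c r k) * e k.
  by rewrite {1}[r]cE; apply: eq_bigr => k _; rewrite /= mulr_algl.
pose E i : hurw m R := hjet dRcom (e i).
have E0 i : hev (E i) = e i by rewrite /hev /E /hjet apply_theta0.
have [b Yb] := hurw_span cE E0 (Y : hurw m R).
have hderC := hder_commuting.
(* The coefficient at t of f(Y) is the constant coefficient of its t-th derivative, that is, the
   value of theta f at Y. *)
have Yf f : f \in Lam -> aeval (hjet dRcom) (jet (@hder m R) (fun _ : 'I_1 => Y)) f = 0.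
  move=> fL; apply/funext => t.
  rewrite -[t in LHS]t0add -apply_theta_hder.
  have jd i r : hjet dRcom (dR i r) = hder i (hjet dRcom r) by exact: hjet_der.
  rewrite -(aeval_theta dRcom _ _ (hderC m R) jd) => [|i v]; last by apply: jetS; exact: hderC.
  rewrite -[LHS]/(hev _) aeval_comp -[RHS](Y0 f t fL); apply: aeval_ext => [r|v] /=.
    by rewrite /hev /hjet apply_theta0.
  by rewrite /hev /jet apply_theta_hder t0add.
pose Q f := generic_value dR e f.
pose Fk f k : {malg L[cmonom (dvarC n m)]} := \sum_(mu <- msupp (Q f)) << c (Q f)@_mu k *g mu >>.
(* The condition on the residue is one linear equation in the coordinates, with coefficients
   [rho (e i)]. *)
pose G : {malg L[cmonom (dvarC n m)]} :=
  \sum_i mconst (dvarC n m) (rho (e i)) * mvar L ((i, tzero m) : dvarC n m) - mconst _ a.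
have Geval (S : comNzRingType) (dS : 'I_m -> S -> S) (phi : {rmorphism L -> S}) (x : 'I_n -> S) :
    aeval phi (jet dS x) G = \sum_i phi (rho (e i)) * x i - phi a.
  apply: etrans (rmorph_sum_mul_sub (aeval phi (jet dS x)) _ _ _) _.
  rewrite [X in _ - X]aevalC; congr (_ - _); apply: eq_bigr => i _.
  rewrite [X in X * _]aevalC [X in _ * X]aevalX; by rewrite /jet /= apply_theta0.
have [|x x0] := @hurw_diff_closed n (G :: [seq Fk f k | f <- Lam, k <- enum 'I_n]) b closed.
  move=> F; rewrite inE => /orP[/eqP->|/allpairsP[[f k] /= [fL _ ->]]].
    rewrite Geval; apply/eqP; rewrite subr_eq0; apply/eqP.
    (* [rho] maps Y to the jet of [a] and the jet of [e i] to that of [rho (e i)], so it turns the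
       decomposition of Y into the equation [G]. *)
    have := congr1 (hmap rho) Yb; rewrite rmorph_sum => YE.
    have aE : hjet dLcom a = hmap rho (Y : hurw m R).
      by apply/funext => t; rewrite /hmap Ylift.
    rewrite [RHS]aE YE; apply: eq_bigr => i _; rewrite rmorphM mulrC; congr (_ * _).
      apply/funext => t; exact: (esym (rho_alg (b i t))).
    apply/funext => t; rewrite /E /hmap /hjet; apply/esym.
    exact: (apply_theta_morph rho_d).
  (* By freeness over H(L), the single equation f(Y) = 0 in H(R) splits into the vanishing of its n
     coordinates. *)
  suff /(hurw_free efree E0) : \sum_k hmap (in_alg R) (aeval (hjet dLcom) (jet (@hder m L) b) (Fk f k)) * E k = 0.
    exact.
  have sE l : hmap (in_alg R) (hjet dLcom l) = hjet dRcom (in_alg R l).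
    apply/funext => t; rewrite /hmap /hjet.
    by apply: (apply_theta_morph (phi := in_alg R)) => i z; rewrite /= dRL.
  rewrite -(aeval_coord (phi := hjet dRcom) (jet (@hder m L) b) (Q f) cE' sE) -(Yf f fL).
  have hmd i (z : hurw m L) : hmap (in_alg R) (hder i z) = hder i (hmap (in_alg R) z).
    exact: hmap_der.
  rewrite (aeval_ext (w' := jet (@hder m R) (fun i => hmap (in_alg R) (b i))) (phi' := hjet dRcom)) //; last first.
    by move=> v; rewrite /jet /= (apply_theta_morph hmd).
  rewrite (aeval_generic dRcom (hderC m R)); last by move=> i r; exact: hjet_der.
  apply: aeval_ext => // v; rewrite /jet; congr (apply_theta _ _ _).
  by rewrite Yb; apply: eq_bigr => i _; rewrite mulrC.
exists (\sum_i e i * (x i)%:A); split=> [|f fL].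
  have := x0 G; rewrite inE eqxx => /(_ isT); rewrite Geval => /eqP; rewrite subr_eq0 => /eqP Ga.
  by apply: etrans _ Ga; rewrite rmorph_sum; apply: eq_bigr => i _; rewrite rmorphM rho_alg.
have E1 := aeval_generic (phi := idfun) dRcom dRcom e (fun _ _ => erefl) (fun i => (x i)%:A) f.
apply: etrans (esym E1) _.
have sE (l : L) : in_alg R (idfun l) = idfun (in_alg R l) by [].
have E2 := aeval_coord (phi := idfun) (iota := idfun) (jet dL x) (Q f) cE' sE.
have E3 : aeval idfun (jet dR (fun i => (x i)%:A)) (Q f)
    = aeval idfun (in_alg R \o jet dL x) (Q f).
  apply: aeval_ext => // v; rewrite /jet /=.
  by rewrite -(apply_theta_morph (phi := in_alg R) (d := dL)) // => i z; rewrite /= dRL.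
apply: etrans E3 _; apply: etrans E2 _; apply: big1 => k _.
have -> : aeval idfun (jet dL x) (\sum_(mu <- msupp (Q f)) << c (Q f)@_mu k *g mu >>) = 0.
  apply: (x0 (Fk f k)); rewrite inE; apply/orP; right.
  by apply/allpairsP; exists (f, k); rewrite fL mem_enum.
by rewrite rmorph0 mul0r.
Qed.

End Main.

Theorem theorem3p1 (L : fieldType) (m : nat) (dL : 'I_m -> L -> L)
    (R : comAlgType L) (dR : 'I_m -> R -> R) (mm : R -> Prop)
    (Lam : seq {malg R[cmonom (dvar 1 m)]}) (a : L) :
  [pchar L] =i pred0 ->
  commuting_derivations dL ->
  diff_closed dL ->
  finite_dim R ->
  local_with mm ->
  commuting_derivations dR ->
  (forall i (c : L), dR i (c%:A) = (dL i c)%:A) ->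
  (forall i x, mm x -> mm (dR i x)) ->
  uniq Lam ->
  (forall f, f \in Lam -> ~~ dp_const f) ->
  coherent dR Lam ->
  (forall f, f \in Lam -> dp_eval dL (dp_map (residue mm) f) (fun _ => a) = 0) ->
  dp_eval dL (dp_map (residue mm) (H_Lambda Lam)) (fun _ => a) != 0 ->
  exists b : R, residue mm b = a /\
    (forall f, f \in Lam -> dp_eval dR f (fun _ => b) = 0).
Proof.
move=> char0 dLcom closed fd loc dRcom dRL mmd _ nconst coh Lam0 H0.
have [rho [rhoE rho0 rho_alg rho_d]] := residue_morphism fd loc dRcom closed dRL mmd.
have evE (f : {malg R[cmonom (dvarC 1 m)]}) :
    dp_eval dL (dp_map (residue mm) f) (fun _ => a) = evL rho dL a f.
  apply: etrans (dp_eval_map (residue mm) dL _ f) _.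
  by apply: aeval_ext => // r; rewrite rhoE.
have evH : evL rho dL a (H_Lambda Lam) != 0.
  apply: contra_neq H0 => E; exact: etrans (evE _) E.
have runit x : rho x <> 0 -> exists y, y * x = 1.
  by move=> nx; apply: (local_unit fd loc) => /rho0.
have rnil x : rho x = 0 -> exists N, x ^+ N = 0.
  by move/rho0; exact: mm_nilpotent.
have Lam0' (f : {malg R[cmonom (dvarC 1 m)]}) : f \in Lam -> evL rho dL a f = 0.
  move=> fL; exact: etrans (esym (evE f)) (Lam0 f fL).
have sep0 (f : {malg R[cmonom (dvarC 1 m)]}) : f \in Lam -> evL rho dL a (separant f) <> 0.
  exact: (rmorph_prod_neq0 (F := aeval rho (jet dL (fun _ : 'I_1 => a))) (x := @initial R m) evH).
have [Y [Ylift Y0]] := algebraic_point (Lam := Lam) rho_alg runit rnil dLcom dRcom rho_d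
  nconst coh Lam0' sep0 (elimN eqP evH).
have [b [rb fb]] := rational_point char0 dLcom dRcom dRL rho_alg rho_d closed fd Ylift Y0.
exists b; split; first by rewrite -rhoE.
move=> f fL; exact: etrans (dp_evalE dR _ f) (fb f fL).
Qed.
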